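(* There is a quotient of $F^1(\mathbb Z)$ (by a closed ideal) that cannot be isometrically represented on any $L^p$-space for any $p\in[1,\infty)$. In particular, the class of Banach algebras that act on $L^1$-spaces is not closed under quotients.
   Context: $F^1(\mathbb Z)$ is the Banach subalgebra of $\mathcal B(\ell^1(\mathbb Z))$ generated by the bilateral shift and its inverse. A Banach algebra $A$ can be isometrically represented on (acts on) an $L^p$-space if there are a measure space $(X,\mu)$ and an isometric algebra homomorphism $A\to\mathcal B(L^p(X,\mu))$. *)

(* Defs.v *)
From HB Require Import structures.
From mathcomp Require Import all_boot all_order all_algebra.
From mathcomp Require Import all_classical all_reals all_analysis.
From mathcomp Require Import measurable_realfun complex.

Set Implicit Arguments.
Unset Strict Implicit.
Unset Printing Implicit Defensive.

Import Order.TTheory GRing.Theory Num.Theory.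
Import numFieldNormedType.Exports.

Local Open Scope classical_set_scope.
Local Open Scope ring_scope.
Local Open Scope complex_scope.

(* The norm of a normedModType over R[i] takes its values in R[i]; rnorm is    *)
(* the same norm seen as an element of R.                                      *)
Section RealNorm.
Context (R : realType) (E : normedModType R[i]).
Implicit Types (x y : E) (a : R[i]).

Definition rnorm x : R := complex.Re `|x|.

Lemma rnormE x : `|x| = (rnorm x)%:C.
Proof. by rewrite /rnorm RRe_real// ger0_real. Qed.

Lemma rnorm_ge0 x : 0 <= rnorm x.
Proof. by rewrite -ler0c -rnormE. Qed.

Lemma rnormD x y : rnorm (x + y) <= rnorm x + rnorm y.
Proof. by rewrite -lecR rmorphD/= -!rnormE ler_normD. Qed.

Lemma rnormZ a x : rnorm (a *: x) = Normc.normc a * rnorm x.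
Proof. by apply: complexI; rewrite rmorphM/= -!rnormE normrZ. Qed.

Lemma rnorm0 : rnorm 0 = 0.
Proof. by rewrite /rnorm normr0. Qed.

Lemma rnorm0_eq0 x : rnorm x = 0 -> x = 0.
Proof. by move=> x0; apply/normr0_eq0; rewrite rnormE x0. Qed.

Lemma rnormN x : rnorm (- x) = rnorm x.
Proof. by rewrite /rnorm normrN. Qed.

End RealNorm.

Lemma normc_ge0 (R : rcfType) (a : R[i]) : 0 <= Normc.normc a.
Proof. by case: a => x y; exact: sqrtr_ge0. Qed.

Record submodule (K : pzRingType) (V : lmodType K) := Submodule {
  submodule_set :> V -> Prop ;
  submodule0 : submodule_set 0 ;
  submoduleD : forall x y,
    submodule_set x -> submodule_set y -> submodule_set (x + y) ;
  submoduleZ : forall a x, submodule_set x -> submodule_set (a *: x) }.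

Section SubmoduleType.
Context (K : pzRingType) (V : lmodType K) (S : submodule V).

Definition mem_submodule : {pred V} := fun x => `[< S x >].

Lemma mem_submoduleP x : reflect (S x) (x \in mem_submodule).
Proof. exact: asboolP. Qed.

Lemma submodule_submod_closed : submod_closed mem_submodule.
Proof.
split; first exact/mem_submoduleP/submodule0.
move=> a x y /mem_submoduleP Sx /mem_submoduleP Sy; apply/mem_submoduleP.
by apply: submoduleD => //; exact: submoduleZ.
Qed.

HB.instance Definition _ :=
  GRing.isSubmodClosed.Build K V mem_submodule submodule_submod_closed.

Definition submodType : Type := {x : V | x \in mem_submodule}.

HB.instance Definition _ := Choice.on submodType.
HB.instance Definition _ := SubChoice.on submodType.
HB.instance Definition _ := [SubChoice_isSubLmodule of submodType by <:].

Definition to_submod x (Sx : S x) : submodType :=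
  exist _ x (introT (mem_submoduleP x) Sx).

Lemma submodP (x : submodType) : S (val x).
Proof. exact/mem_submoduleP/valP. Qed.

End SubmoduleType.

Section QuotientModule.
Local Open Scope quotient_scope.
Context (K : pzRingType) (V : lmodType K) (S : submodule V).

Definition eqmod (x y : V) : bool := `[< S (x - y) >].

Lemma submoduleN x : S x -> S (- x).
Proof. by move=> Sx; rewrite -scaleN1r; exact: submoduleZ. Qed.

Lemma submoduleB x y : S x -> S y -> S (x - y).
Proof. by move=> Sx Sy; apply: submoduleD => //; exact: submoduleN. Qed.

Lemma eqmod_refl : reflexive eqmod.
Proof. by move=> x; apply/asboolP; rewrite subrr; exact: submodule0. Qed.

Lemma eqmod_sym : symmetric eqmod.
Proof.
by move=> x y; apply/asboolP/asboolP => /submoduleN; rewrite opprB.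
Qed.

Lemma eqmod_trans : transitive eqmod.
Proof.
move=> y x z /asboolP xy /asboolP yz; apply/asboolP.
by rewrite -(subrKA y); exact: submoduleD.
Qed.

Canonical eqmod_equiv := EquivRel eqmod eqmod_refl eqmod_sym eqmod_trans.

Definition quotmod : Type := {eq_quot eqmod}.

HB.instance Definition _ := Choice.on quotmod.
HB.instance Definition _ := EqQuotient.on quotmod.

Definition pi_quotmod (x : V) : quotmod := \pi_quotmod x.

Lemma pi_quotmodP x y : pi_quotmod x = pi_quotmod y <-> S (x - y).
Proof.
split=> [/eqP|Sxy]; first by rewrite eqmodE => /asboolP.
by apply/eqP; rewrite eqmodE; exact/asboolP.
Qed.

Lemma repr_quotmodK (q : quotmod) : pi_quotmod (repr q) = q.
Proof. exact: reprK. Qed.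

Lemma repr_pi_quotmod x : S (repr (pi_quotmod x) - x).
Proof. by apply/pi_quotmodP; rewrite repr_quotmodK. Qed.

Definition quotmod_add (p q : quotmod) := pi_quotmod (repr p + repr q).
Definition quotmod_opp (q : quotmod) := pi_quotmod (- repr q).
Definition quotmod_scale a (q : quotmod) := pi_quotmod (a *: repr q).

Lemma pi_quotmodD x y :
  pi_quotmod (x + y) = quotmod_add (pi_quotmod x) (pi_quotmod y).
Proof.
apply/esym/pi_quotmodP; rewrite opprD addrACA.
by apply: submoduleD; exact: repr_pi_quotmod.
Qed.

Lemma pi_quotmodN x : pi_quotmod (- x) = quotmod_opp (pi_quotmod x).
Proof.
by apply/esym/pi_quotmodP; rewrite -opprD; apply/submoduleN/repr_pi_quotmod.
Qed.

Lemma pi_quotmodZ a x :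
  pi_quotmod (a *: x) = quotmod_scale a (pi_quotmod x).
Proof.
by apply/esym/pi_quotmodP; rewrite -scalerBr; apply/submoduleZ/repr_pi_quotmod.
Qed.

Lemma quotmod_addA : associative quotmod_add.
Proof.
move=> p q r; rewrite -(repr_quotmodK p) -(repr_quotmodK q) -(repr_quotmodK r).
by rewrite -!pi_quotmodD addrA.
Qed.

Lemma quotmod_addC : commutative quotmod_add.
Proof. by move=> p q; rewrite /quotmod_add addrC. Qed.

Lemma quotmod_add0 : left_id (pi_quotmod 0) quotmod_add.
Proof. by move=> p; rewrite -(repr_quotmodK p) -pi_quotmodD add0r. Qed.

Lemma quotmod_addN : left_inverse (pi_quotmod 0) quotmod_opp quotmod_add.
Proof.
by move=> p; rewrite -(repr_quotmodK p) -pi_quotmodN -pi_quotmodD addNr.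
Qed.

HB.instance Definition _ := GRing.isZmodule.Build quotmod
  quotmod_addA quotmod_addC quotmod_add0 quotmod_addN.

Let pi_quotmodDE x y : pi_quotmod (x + y) = pi_quotmod x + pi_quotmod y.
Proof. exact: pi_quotmodD. Qed.

Lemma quotmod_scaleA a b p :
  quotmod_scale a (quotmod_scale b p) = quotmod_scale (a * b) p.
Proof. by rewrite -(repr_quotmodK p) -!pi_quotmodZ scalerA. Qed.

Lemma quotmod_scale1 : left_id 1 quotmod_scale.
Proof. by move=> p; rewrite -(repr_quotmodK p) -pi_quotmodZ scale1r. Qed.

Lemma quotmod_scaleDr : right_distributive quotmod_scale +%R.
Proof.
move=> a p q; rewrite -(repr_quotmodK p) -(repr_quotmodK q).
by rewrite -pi_quotmodDE -!pi_quotmodZ scalerDr pi_quotmodDE.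
Qed.

Lemma quotmod_scaleDl p : {morph quotmod_scale^~ p : a b / a + b}.
Proof.
move=> a b; rewrite -(repr_quotmodK p).
by rewrite -!pi_quotmodZ scalerDl pi_quotmodDE.
Qed.

HB.instance Definition _ := GRing.Zmodule_isLmodule.Build K quotmod
  quotmod_scaleA quotmod_scale1 quotmod_scaleDr quotmod_scaleDl.

Lemma pi_quotmod_linear : linear pi_quotmod.
Proof. by move=> a x y; rewrite pi_quotmodD pi_quotmodZ. Qed.

HB.instance Definition _ :=
  GRing.isLinear.Build K V quotmod _ pi_quotmod pi_quotmod_linear.

End QuotientModule.

(* Banach algebras need not have a unit.                                       *)
HB.mixin Record isNormedAlgebra (K : numFieldType) A of NormedModule K A := {
  amul : A -> A -> A ;
  amulA : associative amul ;
  amulDl : left_distributive amul +%R ;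
  amulDr : right_distributive amul +%R ;
  amulZl : forall (a : K) x y, amul (a *: x) y = a *: amul x y ;
  amulZr : forall (a : K) x y, amul x (a *: y) = a *: amul x y ;
  ler_norm_amul : forall x y, `|amul x y| <= `|x| * `|y| }.

#[short(type="normedAlgType")]
HB.structure Definition NormedAlgebra (K : numFieldType) :=
  {A of isNormedAlgebra K A & NormedModule K A}.

#[short(type="banachAlgType")]
HB.structure Definition BanachAlgebra (K : numFieldType) :=
  {A of NormedAlgebra K A & Complete A}.

Definition isometric_homomorphism (K : numFieldType) (A B : normedAlgType K)
    (phi : A -> B) : Prop :=
  [/\ linear phi, {morph phi : x y / amul x y} & forall x, `|phi x| = `|x|].

Record closedIdeal (K : numFieldType) (A : normedAlgType K) := ClosedIdeal {
  closedIdeal_submodule :> submodule A ;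
  closedIdeal_closed : closed (closedIdeal_submodule : set A) ;
  closedIdealMl : forall x y,
    closedIdeal_submodule y -> closedIdeal_submodule (amul x y) ;
  closedIdealMr : forall x y,
    closedIdeal_submodule x -> closedIdeal_submodule (amul x y) }.

Section QuotientAlgebra.
Context (R : realType) (A : normedAlgType R[i]) (J : closedIdeal A).

Definition quotAlg : Type := quotmod J.

HB.instance Definition _ := GRing.Lmodule.on quotAlg.

Definition pi_quotAlg : A -> quotAlg := @pi_quotmod _ _ J.

HB.instance Definition _ := GRing.Linear.on pi_quotAlg.

Implicit Types (p q r : quotAlg) (x y z : A).

Lemma pi_quotAlg_surj q : exists x, pi_quotAlg x = q.
Proof. by exists (repr q); exact: repr_quotmodK. Qed.

Definition quotAlg_norm q : R := inf [set rnorm x | x in pi_quotAlg @^-1` [set q]].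

Lemma quotAlg_norm_has_inf q :
  has_inf [set rnorm x | x in pi_quotAlg @^-1` [set q]].
Proof.
split; last by exists 0 => _ [x _ <-]; exact: rnorm_ge0.
by have [x xq] := pi_quotAlg_surj q; exists (rnorm x); exists x.
Qed.

Lemma quotAlg_norm_le x : quotAlg_norm (pi_quotAlg x) <= rnorm x.
Proof.
have [_ lb] := quotAlg_norm_has_inf (pi_quotAlg x).
by apply: ge_inf => //; exists x.
Qed.

Lemma le_quotAlg_norm c k q : 0 <= k ->
  (forall x, pi_quotAlg x = q -> c <= k * rnorm x) -> c <= k * quotAlg_norm q.
Proof.
move=> k0 ck; have [ne lb] := quotAlg_norm_has_inf q.
move: k0; rewrite le_eqVlt => /predU1P[k0|k0].
  have [x xq] := pi_quotAlg_surj q.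
  by rewrite -k0 mul0r; have := ck _ xq; rewrite -k0 mul0r.
rewrite mulrC -ler_pdivrMr//; apply: lb_le_inf => // _ [x xq <-].
by rewrite ler_pdivrMr// mulrC ck.
Qed.

Lemma quotAlg_norm_ge0 q : 0 <= quotAlg_norm q.
Proof.
by rewrite -[leRHS]mul1r le_quotAlg_norm// => x _; rewrite mul1r rnorm_ge0.
Qed.

Lemma quotAlg_normD p q :
  quotAlg_norm (p + q) <= quotAlg_norm p + quotAlg_norm q.
Proof.
rewrite -lerBlDr -[leRHS]mul1r le_quotAlg_norm// => x xp.
rewrite mul1r lerBlDr -lerBlDl -[leRHS]mul1r le_quotAlg_norm// => y yq.
rewrite mul1r lerBlDl -xp -yq -raddfD.
by rewrite (le_trans (quotAlg_norm_le _))// rnormD.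
Qed.

Let quotAlg_normZ_le a q :
  quotAlg_norm (a *: q) <= Normc.normc a * quotAlg_norm q.
Proof.
rewrite le_quotAlg_norm ?normc_ge0// => x xq.
by rewrite -rnormZ -xq -linearZ quotAlg_norm_le.
Qed.

Lemma quotAlg_normZ a q :
  quotAlg_norm (a *: q) = Normc.normc a * quotAlg_norm q.
Proof.
apply/eqP; rewrite eq_le quotAlg_normZ_le/=.
have [->|a0] := eqVneq a 0.
  by rewrite Normc.normc0 mul0r quotAlg_norm_ge0.
rewrite -[in leLHS](scale1r q) -(mulVf a0) -scalerA.
rewrite (le_trans (ler_wpM2l (normc_ge0 _) (quotAlg_normZ_le _ _)))//.
by rewrite mulrA -Normc.normcM mulfV// Normc.normc1 mul1r.
Qed.

Lemma quotAlg_norm0_eq0 q : quotAlg_norm q = 0 -> q = 0.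
Proof.
have [x <-] := pi_quotAlg_surj q => x0.
suff Jx : J x by apply/pi_quotmodP; rewrite subr0.
apply: (@closedIdeal_closed _ _ J) => B /nbhs_ballP[e /= e0 eB].
have e0R : 0 < complex.Re e by move: e0; rewrite ltcE/= => /andP[].
have [_ [y yx <-] ye] :=
  inf_adherent e0R (quotAlg_norm_has_inf (pi_quotAlg x)).
exists (x - y); split.
  by apply/pi_quotmodP; exact/esym.
apply: eB; rewrite -ball_normE/= opprB addrC subrK rnormE.
rewrite -(@RRe_real _ e) ?gtr0_real// ltcR.
by move: ye; rewrite -/(quotAlg_norm _) x0 add0r.
Qed.

Let quotAlg_ler_normD p q : (quotAlg_norm (p + q))%:C <=
  (quotAlg_norm p)%:C + (quotAlg_norm q)%:C.
Proof. by rewrite -rmorphD/= lecR quotAlg_normD. Qed.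

Let quotAlg_normrZ a q :
  (quotAlg_norm (a *: q))%:C = `|a| * (quotAlg_norm q)%:C.
Proof. by rewrite quotAlg_normZ rmorphM. Qed.

Let quotAlg_normr0_eq0 q : (quotAlg_norm q)%:C = 0 -> q = 0.
Proof. by move=> /complexI/quotAlg_norm0_eq0. Qed.

HB.instance Definition _ := Lmodule_isNormed.Build R[i] quotAlg
  quotAlg_ler_normD quotAlg_normrZ quotAlg_normr0_eq0.

Lemma rnorm_quotAlg q : rnorm q = quotAlg_norm q.
Proof. by []. Qed.

Definition quotAlg_mul p q : quotAlg := pi_quotAlg (amul (repr p) (repr q)).

Lemma pi_quotAlgM x y :
  pi_quotAlg (amul x y) = quotAlg_mul (pi_quotAlg x) (pi_quotAlg y).
Proof.
apply/esym/pi_quotmodP.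
set u := repr _; set v := repr _.
have -> : amul u v - amul x y = amul (u - x) v + amul x (v - y).
  rewrite !amulDl !amulDr -(scaleN1r x) -(scaleN1r y) amulZl amulZr !scaleN1r.
  by rewrite addrA subrK.
apply: submoduleD; first exact/closedIdealMr/repr_pi_quotmod.
exact/closedIdealMl/repr_pi_quotmod.
Qed.

Let quotAlg_mulA : associative quotAlg_mul.
Proof.
move=> p q r; have [x <-] := pi_quotAlg_surj p.
have [y <-] := pi_quotAlg_surj q; have [z <-] := pi_quotAlg_surj r.
by rewrite -!pi_quotAlgM amulA.
Qed.

Let quotAlg_mulDl : left_distributive quotAlg_mul +%R.
Proof.
move=> p q r; have [x <-] := pi_quotAlg_surj p.
have [y <-] := pi_quotAlg_surj q; have [z <-] := pi_quotAlg_surj r.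
by rewrite -raddfD -!pi_quotAlgM amulDl raddfD.
Qed.

Let quotAlg_mulDr : right_distributive quotAlg_mul +%R.
Proof.
move=> p q r; have [x <-] := pi_quotAlg_surj p.
have [y <-] := pi_quotAlg_surj q; have [z <-] := pi_quotAlg_surj r.
by rewrite -raddfD -!pi_quotAlgM amulDr raddfD.
Qed.

Let quotAlg_mulZl a p q : quotAlg_mul (a *: p) q = a *: quotAlg_mul p q.
Proof.
have [x <-] := pi_quotAlg_surj p; have [y <-] := pi_quotAlg_surj q.
by rewrite -linearZ -!pi_quotAlgM amulZl linearZ.
Qed.

Let quotAlg_mulZr a p q : quotAlg_mul p (a *: q) = a *: quotAlg_mul p q.
Proof.
have [x <-] := pi_quotAlg_surj p; have [y <-] := pi_quotAlg_surj q.
by rewrite -linearZ -!pi_quotAlgM amulZr linearZ.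
Qed.

Let quotAlg_normM p q : `|quotAlg_mul p q| <= `|p| * `|q|.
Proof.
rewrite !rnormE -rmorphM/= lecR !rnorm_quotAlg.
apply: le_quotAlg_norm (quotAlg_norm_ge0 _) _ => y yq.
rewrite mulrC; apply: le_quotAlg_norm (rnorm_ge0 _) _ => x xp.
rewrite -xp -yq -pi_quotAlgM (le_trans (quotAlg_norm_le _))//.
by rewrite -lecR rmorphM/= -!rnormE mulrC ler_norm_amul.
Qed.

HB.instance Definition _ := isNormedAlgebra.Build R[i] quotAlg quotAlg_mulA
  quotAlg_mulDl quotAlg_mulDr quotAlg_mulZl quotAlg_mulZr quotAlg_normM.

End QuotientAlgebra.

Record closedSubalgebra (K : numFieldType) (A : normedAlgType K) :=
  ClosedSubalgebra {
    closedSubalgebra_submodule :> submodule A ;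
    closedSubalgebra_closed : closed (closedSubalgebra_submodule : set A) ;
    closedSubalgebraM : forall x y, closedSubalgebra_submodule x ->
      closedSubalgebra_submodule y -> closedSubalgebra_submodule (amul x y) }.

Section GeneratedSubalgebra.
Context (K : numFieldType) (A : normedAlgType K) (G : set A).

(* Subalgebras are not required to contain a unit.                             *)
Definition generated_set : set A :=
  \bigcap_(B in [set B : closedSubalgebra A | G `<=` (B : set A)]) (B : set A).

Lemma sub_generated_set : G `<=` generated_set.
Proof. by move=> x Gx B /(_ x Gx). Qed.

Let generated_set0 : generated_set 0.
Proof. by move=> B _; exact: submodule0. Qed.

Let generated_setD x y :
  generated_set x -> generated_set y -> generated_set (x + y).
Proof. by move=> xG yG B GB; apply: submoduleD; [exact: xG|exact: yG]. Qed.

Let generated_setZ a x : generated_set x -> generated_set (a *: x).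
Proof. by move=> xG B GB; apply: submoduleZ; exact: xG. Qed.

Definition generated_submodule : submodule A :=
  Submodule generated_set0 generated_setD generated_setZ.

Let generated_set_closed : closed (generated_submodule : set A).
Proof. by apply: closed_bigI => B _; exact: closedSubalgebra_closed. Qed.

Let generated_setM x y :
  generated_set x -> generated_set y -> generated_set (amul x y).
Proof.
by move=> xG yG B GB; apply: closedSubalgebraM; [exact: xG|exact: yG].
Qed.

Definition generated_subalgebra : closedSubalgebra A :=
  ClosedSubalgebra generated_set_closed generated_setM.

End GeneratedSubalgebra.

Section SubalgebraType.
Context (K : numFieldType) (A : normedAlgType K) (B : closedSubalgebra A).

Definition subAlg : Type := submodType B.

HB.instance Definition _ := GRing.Lmodule.on subAlg.
HB.instance Definition _ := SubChoice.on subAlg.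

Implicit Types x y z : subAlg.

Let subAlg_normD x y : `|val (x + y)| <= `|val x| + `|val y|.
Proof. exact: ler_normD. Qed.

Let subAlg_normZ a x : `|val (a *: x)| = `|a| * `|val x|.
Proof. exact: normrZ. Qed.

Let subAlg_norm0_eq0 x : `|val x| = 0 -> x = 0.
Proof. by move=> /normr0_eq0 x0; exact: val_inj. Qed.

HB.instance Definition _ := Lmodule_isNormed.Build K subAlg
  subAlg_normD subAlg_normZ subAlg_norm0_eq0.

Definition subAlg_mul x y : subAlg :=
  to_submod (closedSubalgebraM (submodP x) (submodP y)).

Let subAlg_mulA : associative subAlg_mul.
Proof. by move=> x y z; apply: val_inj; exact: amulA. Qed.

Let subAlg_mulDl : left_distributive subAlg_mul +%R.
Proof. by move=> x y z; apply: val_inj; exact: amulDl. Qed.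

Let subAlg_mulDr : right_distributive subAlg_mul +%R.
Proof. by move=> x y z; apply: val_inj; exact: amulDr. Qed.

Let subAlg_mulZl a x y : subAlg_mul (a *: x) y = a *: subAlg_mul x y.
Proof. by apply: val_inj; exact: amulZl. Qed.

Let subAlg_mulZr a x y : subAlg_mul x (a *: y) = a *: subAlg_mul x y.
Proof. by apply: val_inj; exact: amulZr. Qed.

Let subAlg_normM x y : `|subAlg_mul x y| <= `|x| * `|y|.
Proof. exact: ler_norm_amul. Qed.

HB.instance Definition _ := isNormedAlgebra.Build K subAlg subAlg_mulA
  subAlg_mulDl subAlg_mulDr subAlg_mulZl subAlg_mulZr subAlg_normM.

End SubalgebraType.

Section BoundedOperators.
Context (R : realType) (E : normedModType R[i]).

Definition bounded_operator : set (E -> E) :=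
  [set f | linear f /\ exists M : R, forall x, rnorm (f x) <= M * rnorm x].

Let bounded_operator0 : bounded_operator 0.
Proof.
have fct0 (x : E) : (0 : E -> E) x = 0 by [].
split; first by move=> a x y; rewrite !fct0 scaler0 addr0.
by exists 0 => x; rewrite fct0 rnorm0 mul0r.
Qed.

Let bounded_operatorD f g :
  bounded_operator f -> bounded_operator g -> bounded_operator (f + g).
Proof.
move=> [lf [M fM]] [lg [N gN]]; split.
  move=> a x y; have fctD (z : E) : (f + g) z = f z + g z by [].
  by rewrite !fctD lf lg scalerDr addrACA.
exists (M + N) => x; rewrite (le_trans (rnormD _ _))// mulrDl.
by rewrite lerD.
Qed.

Let bounded_operatorZ (a : R[i]) f :
  bounded_operator f -> bounded_operator (a *: f).
Proof.
move=> [lf [M fM]]; split.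
  move=> b x y; have fctZ (z : E) : (a *: f) z = a *: f z by [].
  by rewrite !fctZ lf scalerDr !scalerA mulrC.
exists (Normc.normc a * M) => x; rewrite [X in rnorm X](_ : _ = a *: f x)//.
rewrite rnormZ -mulrA.
by rewrite ler_wpM2l// normc_ge0.
Qed.

Definition bounded_operator_submodule : submodule (E -> E : lmodType R[i]) :=
  @Submodule R[i] (E -> E : lmodType R[i]) bounded_operator bounded_operator0
    bounded_operatorD bounded_operatorZ.

Definition Bop : Type := submodType bounded_operator_submodule.

HB.instance Definition _ := GRing.Lmodule.on Bop.
HB.instance Definition _ := SubChoice.on Bop.

Definition Bop_fun (T : Bop) : E -> E := val T.
Coercion Bop_fun : Bop >-> Funclass.

Implicit Types (T U : Bop) (x y : E).

Definition to_Bop (f : E -> E) (lf : linear f)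
    (bf : exists M : R, forall x, rnorm (f x) <= M * rnorm x) : Bop :=
  @to_submod _ _ bounded_operator_submodule f (conj lf bf).

Lemma Bop_linear T : linear T.
Proof. by have [] := submodP T. Qed.

HB.instance Definition _ T := GRing.isLinear.Build R[i] E E _ T (@Bop_linear T).

Let BopD T x y : T (x + y) = T x + T y.
Proof. exact: linearD. Qed.

Let BopZ T a x : T (a *: x) = a *: T x.
Proof. exact: linearZ. Qed.

Lemma Bop_bounded T : exists M : R, forall x, rnorm (T x) <= M * rnorm x.
Proof. by have [] := submodP T. Qed.

Lemma BopP T U : T =1 U -> T = U.
Proof. by move=> TU; apply/val_inj/funext. Qed.

Lemma Bop_addE T U x : (T + U : Bop) x = T x + U x.
Proof. by []. Qed.

Lemma Bop_scaleE a T x : (a *: T : Bop) x = a *: T x.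
Proof. by []. Qed.

Definition opnorm T : R := sup [set rnorm (T x) | x in [set x | `|x| <= 1]].

Let unit_ballP x : (`|x| <= 1) = (rnorm x <= 1).
Proof. by rewrite rnormE -lecR. Qed.

Let opnorm_has_sup T : has_sup [set rnorm (T x) | x in [set x | `|x| <= 1]].
Proof.
split; first by exists (rnorm (T 0)); exists 0 => //=; rewrite normr0.
have [M TM] := Bop_bounded T; exists `|M| => _ [x /= x1 <-].
rewrite (le_trans (TM x))// (le_trans (ler_wpM2r (rnorm_ge0 _) (ler_norm M)))//.
by rewrite ler_piMr// -unit_ballP.
Qed.

Lemma opnorm_ge0 T : 0 <= opnorm T.
Proof.
apply: sup_upper_bound; first exact: opnorm_has_sup.
by exists 0 => /=; rewrite ?normr0// linear0 rnorm0.
Qed.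

Lemma ler_opnorm T x : rnorm (T x) <= opnorm T * rnorm x.
Proof.
have [->|x0] := eqVneq x 0; first by rewrite linear0 rnorm0 mulr0.
have nx0 : 0 < rnorm x.
  by rewrite lt_neqAle rnorm_ge0 andbT eq_sym; apply: contra x0 => /eqP/rnorm0_eq0->.
have nc : Normc.normc ((rnorm x)^-1)%:C = (rnorm x)^-1.
  by rewrite /= expr0n/= addr0 sqrtr_sqr ger0_norm// invr_ge0 ltW.
rewrite -ler_pdivrMr// mulrC -[X in X * _]nc -rnormZ -linearZ.
apply: sup_upper_bound; first exact: opnorm_has_sup.
by exists ((rnorm x)^-1%:C *: x) => //=; rewrite unit_ballP rnormZ nc mulVf// gt_eqF.
Qed.

Lemma opnorm_le T (M : R) : 0 <= M ->
  (forall x, rnorm (T x) <= M * rnorm x) -> opnorm T <= M.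
Proof.
move=> M0 TM; apply: ge_sup; first by have [] := opnorm_has_sup T.
move=> _ [x /= x1 <-]; rewrite (le_trans (TM x))//.
by rewrite ler_piMr// -unit_ballP.
Qed.

Let opnormD T U : (opnorm (T + U))%:C <= (opnorm T)%:C + (opnorm U)%:C.
Proof.
rewrite -rmorphD/= lecR opnorm_le ?addr_ge0 ?opnorm_ge0// => x.
by rewrite (le_trans (rnormD _ _))// mulrDl lerD// ler_opnorm.
Qed.

Let opnormZ_le a T : opnorm (a *: T) <= Normc.normc a * opnorm T.
Proof.
rewrite opnorm_le ?mulr_ge0 ?opnorm_ge0 ?normc_ge0// => x.
rewrite Bop_scaleE rnormZ -mulrA.
by rewrite ler_wpM2l ?normc_ge0// ler_opnorm.
Qed.

Let opnormZ a T : (opnorm (a *: T))%:C = `|a| * (opnorm T)%:C.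
Proof.
rewrite -[X in X * _]/(Normc.normc a)%:C -rmorphM; congr _%:C.
apply/eqP; rewrite eq_le opnormZ_le/=.
have [->|a0] := eqVneq a 0.
  by rewrite Normc.normc0 mul0r opnorm_ge0.
rewrite -[in leLHS](scale1r T) -(mulVf a0) -scalerA.
rewrite (le_trans (ler_wpM2l (normc_ge0 _) (opnormZ_le _ _)))//.
by rewrite mulrA -Normc.normcM mulfV// Normc.normc1 mul1r.
Qed.

Let opnorm0_eq0 T : (opnorm T)%:C = 0 -> T = 0.
Proof.
move=> /complexI T0; apply: BopP => x; apply: rnorm0_eq0.
by apply/eqP; rewrite eq_le rnorm_ge0 andbT -(mul0r (rnorm x)) -T0 ler_opnorm.
Qed.

HB.instance Definition _ :=
  Lmodule_isNormed.Build R[i] Bop opnormD opnormZ opnorm0_eq0.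

Lemma rnorm_Bop T : rnorm T = opnorm T.
Proof. by []. Qed.

Let comp_linear T U : linear (T \o U).
Proof. by move=> a x y /=; rewrite !linearP. Qed.

Let comp_bounded T U : exists M : R, forall x, rnorm ((T \o U) x) <= M * rnorm x.
Proof.
exists (opnorm T * opnorm U) => x /=; rewrite (le_trans (ler_opnorm _ _))//.
by rewrite -mulrA ler_wpM2l ?opnorm_ge0// ler_opnorm.
Qed.

Definition Bop_comp T U : Bop := to_Bop (comp_linear T U) (comp_bounded T U).

Lemma Bop_compE T U x : Bop_comp T U x = T (U x).
Proof. by []. Qed.

Let Bop_compA : associative Bop_comp.
Proof. by move=> T U V; exact: BopP. Qed.

Let Bop_compDl : left_distributive Bop_comp +%R.
Proof.
by move=> T U V; apply: BopP => x; rewrite Bop_addE !Bop_compE Bop_addE.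
Qed.

Let Bop_compDr : right_distributive Bop_comp +%R.
Proof. by move=> T U V; apply: BopP => x; exact: linearD. Qed.

Let Bop_compZl a T U : Bop_comp (a *: T) U = a *: Bop_comp T U.
Proof.
by apply: BopP => x; rewrite Bop_scaleE !Bop_compE Bop_scaleE.
Qed.

Let Bop_compZr a T U : Bop_comp T (a *: U) = a *: Bop_comp T U.
Proof. by apply: BopP => x; rewrite Bop_scaleE !Bop_compE Bop_scaleE BopZ. Qed.

Let Bop_norm_comp T U : `|Bop_comp T U| <= `|T| * `|U|.
Proof.
rewrite !rnormE -rmorphM/= lecR !rnorm_Bop opnorm_le ?mulr_ge0 ?opnorm_ge0// => x.
rewrite Bop_compE (le_trans (ler_opnorm _ _))//.
by rewrite -mulrA ler_wpM2l ?opnorm_ge0// ler_opnorm.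
Qed.

HB.instance Definition _ := isNormedAlgebra.Build R[i] Bop Bop_compA
  Bop_compDl Bop_compDr Bop_compZl Bop_compZr Bop_norm_comp.

End BoundedOperators.

Section ComplexLp.
Context d (T : measurableType d) (R : realType).
Context (mu : {measure set T -> \bar R}) (p : R) (p1 : 1 <= p).
Implicit Types (f g : T -> R[i]) (a : R[i]).

Definition cmeasurable f : Prop :=
  measurable_fun [set: T] (@complex.Re R \o f) /\
  measurable_fun [set: T] (@complex.Im R \o f).

Definition cLnorm f : \bar R := 'N[mu]_(p%:E)[EFin \o (@Normc.normc R \o f)].

Lemma cLnormE f :
  cLnorm f = ((\int[mu]_x (`|Normc.normc (f x)| `^ p)%:E) `^ p^-1)%E.
Proof. by rewrite /cLnorm unlock. Qed.

Let pe1 : (1 <= p%:E)%E. Proof. by rewrite lee_fin. Qed.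

Let p_gt0 : 0 < p. Proof. exact: lt_le_trans p1. Qed.

Lemma measurable_normc f : cmeasurable f ->
  measurable_fun [set: T] (@Normc.normc R \o f).
Proof.
move=> [mRe mIm].
rewrite (_ : _ \o _ = Num.sqrt \o
    (fun x => complex.Re (f x) ^+ 2 + complex.Im (f x) ^+ 2)); last first.
  by apply/funext => x /=; case: (f x).
apply: measurableT_comp.
  by apply: continuous_measurable_fun; exact: sqrt_continuous.
by apply: measurable_funD; exact: measurable_funX.
Qed.

Lemma cmeasurable0 : cmeasurable 0.
Proof. by split; exact: measurable_cst. Qed.

Lemma cmeasurableD f g : cmeasurable f -> cmeasurable g -> cmeasurable (f + g).
Proof.
move=> [fR fI] [gR gI]; split.
  rewrite (_ : _ \o _ = (@complex.Re R \o f) \+ (@complex.Re R \o g)).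
    exact: measurable_funD.
  by apply/funext => x /=; rewrite fctE; case: (f x) (g x) => [? ?] [].
rewrite (_ : _ \o _ = (@complex.Im R \o f) \+ (@complex.Im R \o g)).
  exact: measurable_funD.
by apply/funext => x /=; rewrite fctE; case: (f x) (g x) => [? ?] [].
Qed.

Lemma cmeasurableZ a f : cmeasurable f -> cmeasurable (a *: f).
Proof.
case: a => u v [fR fI]; split.
  rewrite (_ : _ \o _ =
      (cst u \* (@complex.Re R \o f)) \- (cst v \* (@complex.Im R \o f))).
    by apply: measurable_funB; apply: measurable_funM.
  by apply/funext => x /=; rewrite fctE; case: (f x).
rewrite (_ : _ \o _ =
    (cst u \* (@complex.Im R \o f)) \+ (cst v \* (@complex.Re R \o f))).
  by apply: measurable_funD; apply: measurable_funM.
by apply/funext => x /=; rewrite fctE; case: (f x).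
Qed.

Let le_Lnorm (u v : T -> R) : measurable_fun [set: T] u ->
  measurable_fun [set: T] v -> (forall x, 0 <= u x <= v x) ->
  ('N[mu]_(p%:E)[EFin \o u] <= 'N[mu]_(p%:E)[EFin \o v])%E.
Proof.
move=> mu_ mv uv; rewrite unlock.
have mP (w : T -> R) : measurable_fun [set: T] w ->
    measurable_fun [set: T] (fun x => `|(EFin \o w) x| `^ p)%E.
  move=> mw; rewrite [X in measurable_fun _ X](_ : _ =
    EFin \o (fun x => `|w x| `^ p)).
    apply/measurable_EFinP; apply: (@measurableT_comp _ _ _ _ _ _ (@powR R ^~ p)).
      exact: measurable_powR.
    exact: measurableT_comp.
  by [].
apply: gt0_ler_poweR.
- by rewrite invr_ge0 ltW.
- by rewrite in_itv/= leey andbT integral_ge0// => x _; exact: poweR_ge0.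
- by rewrite in_itv/= leey andbT integral_ge0// => x _; exact: poweR_ge0.
apply: ge0_le_integral => //; [|exact: mP|exact: mP|].
  by move=> x _; exact: poweR_ge0.
move=> x _; have /andP[u0 uvx] := uv x.
rewrite /= lee_fin ge0_ler_powR ?(ltW p_gt0) ?nnegrE//.
by rewrite !ger0_norm// (le_trans u0).
Qed.

Lemma cLnorm_ge0 f : (0 <= cLnorm f)%E.
Proof. exact: Lnorm_ge0. Qed.

Lemma cLnorm0 : cLnorm 0 = 0%E.
Proof.
rewrite /cLnorm -(@Lnorm0 _ _ _ mu p%:E); last by rewrite eqe gt_eqF.
by congr Lnorm; apply/funext => x; congr EFin; exact: Normc.normc0.
Qed.

Lemma cLnormD f g : cmeasurable f -> cmeasurable g ->
  (cLnorm (f + g)%R <= cLnorm f + cLnorm g)%E.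
Proof.
move=> mf mg.
apply: (@le_trans _ _ ('N[mu]_(p%:E)[EFin \o
    ((@Normc.normc R \o f) \+ (@Normc.normc R \o g))%R])%E).
  apply: le_Lnorm.
  - exact/measurable_normc/cmeasurableD.
  - by apply: measurable_funD; exact: measurable_normc.
  - by move=> x /=; rewrite normc_ge0/= le_normcD.
by apply: eminkowski => //; exact: measurable_normc.
Qed.

Lemma cLnormZ a f : cmeasurable f -> (cLnorm f < +oo)%E ->
  cLnorm (a *: f) = ((Normc.normc a)%:E * cLnorm f)%E.
Proof.
move=> mf fy.
have Lf : (@Normc.normc R \o f) \in Lfun mu p%:E.
  rewrite inE/=; apply/andP; split; rewrite inE/=; last exact: fy.
  exact: measurable_normc.
have := LnormZ (Lfun_Sub pe1 Lf) (Normc.normc a).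
rewrite ger0_norm ?normc_ge0// => <-.
congr Lnorm; apply/funext => x; congr EFin.
exact: Normc.normcM.
Qed.

Lemma cLnorm_ae f g : cmeasurable f -> cmeasurable g ->
  f = g %[ae mu] -> cLnorm f = cLnorm g.
Proof.
move=> mf mg fg; rewrite /cLnorm unlock.
have mP h : cmeasurable h ->
    measurable_fun [set: T] (fun x => `|(EFin \o (@Normc.normc R \o h)) x| `^ p)%E.
  move=> mh; rewrite [X in measurable_fun _ X](_ : _ =
    EFin \o (fun x => `|Normc.normc (h x)| `^ p)).
    apply/measurable_EFinP; apply: (@measurableT_comp _ _ _ _ _ _ (@powR R ^~ p)).
      exact: measurable_powR.
    by apply: measurableT_comp => //; exact: measurable_normc.
  by [].
rewrite (@ae_eq_integral _ _ _ mu [set: T] _ _ measurableT (mP _ mf) (mP _ mg))//.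
by apply: filterS fg => x /(_ I) /= fgx _; rewrite fgx.
Qed.

Lemma cLnorm_eq0 f : cmeasurable f -> cLnorm f = 0%E -> f = 0 %[ae mu].
Proof.
move=> mf /Lnorm_eq0_eq0 f0.
have /f0 : measurable_fun [set: T] (EFin \o (@Normc.normc R \o f)).
  by apply/measurable_EFinP; exact: measurable_normc.
have p0 : (0 < p%:E)%E by rewrite lte_fin.
move=> /(_ p0); apply: filterS => x /= + _ => /(_ I)[].
exact: Normc.eq0_normc.
Qed.

Definition Lp_fun : set (T -> R[i]) :=
  [set f | cmeasurable f /\ (cLnorm f < +oo)%E].

Let Lp_fun0 : Lp_fun 0.
Proof. by split; [exact: cmeasurable0|rewrite cLnorm0]. Qed.

Let Lp_funD f g : Lp_fun f -> Lp_fun g -> Lp_fun (f + g).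
Proof.
move=> [mf fy] [mg gy]; split; first exact: cmeasurableD.
by rewrite (le_lt_trans (cLnormD _ _))// lte_add_pinfty.
Qed.

Let Lp_funZ a f : Lp_fun f -> Lp_fun (a *: f).
Proof.
move=> [mf fy]; split; first exact: cmeasurableZ.
by rewrite cLnormZ// lte_mul_pinfty// lee_fin normc_ge0.
Qed.

Definition Lp_fun_submodule : submodule (T -> R[i] : lmodType R[i]) :=
  @Submodule R[i] (T -> R[i] : lmodType R[i]) Lp_fun Lp_fun0 Lp_funD Lp_funZ.

Definition LpFun : Type := submodType Lp_fun_submodule.

HB.instance Definition _ := GRing.Lmodule.on LpFun.
HB.instance Definition _ := SubChoice.on LpFun.

Definition LpFun_fun (f : LpFun) : T -> R[i] := val f.
Coercion LpFun_fun : LpFun >-> Funclass.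

Definition to_LpFun f (mf : cmeasurable f) (fy : (cLnorm f < +oo)%E) : LpFun :=
  @to_submod _ _ Lp_fun_submodule f (conj mf fy).

Lemma LpFun_measurable (f : LpFun) : cmeasurable f.
Proof. by have [] := submodP f. Qed.

Lemma LpFun_finite (f : LpFun) : (cLnorm f < +oo)%E.
Proof. by have [] := submodP f. Qed.

Lemma LpFunP (f g : LpFun) : f =1 g -> f = g.
Proof. by move=> fg; apply/val_inj/funext. Qed.

Lemma LpFun_addE (f g : LpFun) x : (f + g : LpFun) x = f x + g x.
Proof. by []. Qed.

Lemma LpFun_scaleE a (f : LpFun) x : (a *: f : LpFun) x = a *: f x.
Proof. by []. Qed.

Definition Lp_null : set LpFun := [set f | (f : T -> R[i]) = 0 %[ae mu]].

Let Lp_null0 : Lp_null 0.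
Proof. exact: aeW. Qed.

Let Lp_nullD (f g : LpFun) : Lp_null f -> Lp_null g -> Lp_null (f + g).
Proof.
apply: filterS2 => x /(_ I) f0 /(_ I) g0 _.
by rewrite [LHS](_ : _ = f x + g x)// f0 g0 addr0.
Qed.

Let Lp_nullZ a (f : LpFun) : Lp_null f -> Lp_null (a *: f).
Proof.
apply: filterS => x /(_ I) f0 _.
by rewrite [LHS](_ : _ = a *: f x)// f0 scaler0.
Qed.

Definition Lp_null_submodule : submodule LpFun :=
  Submodule Lp_null0 Lp_nullD Lp_nullZ.

Definition Lp : Type := quotmod Lp_null_submodule.

HB.instance Definition _ := GRing.Lmodule.on Lp.

Definition pi_Lp : LpFun -> Lp := @pi_quotmod _ _ Lp_null_submodule.

HB.instance Definition _ := GRing.Linear.on pi_Lp.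

Definition Lp_norm (u : Lp) : R := fine (cLnorm (repr u : LpFun)).

Lemma pi_LpP (f g : LpFun) :
  pi_Lp f = pi_Lp g <-> (f : T -> R[i]) = g %[ae mu].
Proof.
rewrite /pi_Lp; split => [/pi_quotmodP|fg].
  apply: filterS => x /(_ I) fg _; apply/eqP; rewrite -subr_eq0; exact/eqP.
apply/pi_quotmodP; apply: filterS fg => x /(_ I) fg _.
by rewrite [LHS](_ : _ = f x - g x)// fg subrr.
Qed.

Lemma Lp_normE (f : LpFun) : Lp_norm (pi_Lp f) = fine (cLnorm f).
Proof.
congr fine; apply: cLnorm_ae.
- exact: LpFun_measurable.
- exact: LpFun_measurable.
- by apply/pi_LpP; exact: repr_quotmodK.
Qed.

Lemma pi_Lp_surj (u : Lp) : exists f : LpFun, pi_Lp f = u.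
Proof. by exists (repr u); exact: repr_quotmodK. Qed.

Lemma cLnorm_fin_num (f : LpFun) : cLnorm f \is a fin_num.
Proof. by rewrite ge0_fin_numE ?cLnorm_ge0// LpFun_finite. Qed.

Let Lp_normD u v : (Lp_norm (u + v))%:C <= (Lp_norm u)%:C + (Lp_norm v)%:C.
Proof.
have [f <-] := pi_Lp_surj u; have [g <-] := pi_Lp_surj v.
rewrite -rmorphD/= lecR -linearD !Lp_normE -lee_fin EFinD.
rewrite !fineK ?cLnorm_fin_num//.
by apply: cLnormD; exact: LpFun_measurable.
Qed.

Let Lp_normZ_normc a u : Lp_norm (a *: u) = Normc.normc a * Lp_norm u.
Proof.
have [f <-] := pi_Lp_surj u; rewrite -linearZ !Lp_normE.
have -> : cLnorm (a *: f : LpFun) = ((Normc.normc a)%:E * cLnorm f)%E.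
  by apply: cLnormZ; [exact: LpFun_measurable|exact: LpFun_finite].
by rewrite fineM ?cLnorm_fin_num.
Qed.

Let Lp_normZ a u : (Lp_norm (a *: u))%:C = `|a| * (Lp_norm u)%:C.
Proof. by rewrite Lp_normZ_normc rmorphM. Qed.

Let Lp_norm0_eq0 u : (Lp_norm u)%:C = 0 -> u = 0.
Proof.
have [f <-] := pi_Lp_surj u; rewrite Lp_normE => /complexI f0.
rewrite -(linear0 pi_Lp); apply/pi_LpP; apply: cLnorm_eq0.
  exact: LpFun_measurable.
by rewrite -[LHS]fineK ?cLnorm_fin_num// f0.
Qed.

HB.instance Definition _ :=
  Lmodule_isNormed.Build R[i] Lp Lp_normD Lp_normZ Lp_norm0_eq0.

End ComplexLp.

Section CompositionOperator.
Context d (T : measurableType d) (R : realType).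
Context (mu : {measure set T -> \bar R}) (p : R) (p1 : 1 <= p).
Context (tau : T -> T) (mtau : measurable_fun [set: T] tau)
  (mu_tau : forall X, measurable X -> mu (tau @^-1` X) = mu X).

Local Notation LpFun := (LpFun mu p1).
Local Notation Lp := (Lp mu p1).

Let cmeasurable_comp (f : LpFun) : cmeasurable (f \o tau).
Proof.
have [mRe mIm] := LpFun_measurable f.
split; first exact: (measurableT_comp mRe mtau).
exact: (measurableT_comp mIm mtau).
Qed.

Let cLnorm_comp (f : LpFun) : cLnorm mu p (f \o tau) = cLnorm mu p f.
Proof.
have mf : measurable_fun [set: T] (fun x => `|Normc.normc (f x)| `^ p).
  apply: (@measurableT_comp _ _ _ _ _ _ (@powR R ^~ p)).
    exact: measurable_powR.
  by apply: measurableT_comp => //; apply/measurable_normc/LpFun_measurable.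
have int_tau : (\int[mu]_x (`|Normc.normc (f (tau x))| `^ p)%:E =
                \int[mu]_x (`|Normc.normc (f x)| `^ p)%:E)%E.
  have -> : (\int[mu]_x (`|Normc.normc (f x)| `^ p)%:E =
      \int[pushforward mu tau]_x (`|Normc.normc (f x)| `^ p)%:E)%E.
    by apply: eq_measure_integral => X mX _; exact/esym/mu_tau.
  rewrite ge0_integral_pushforward//; exact/measurable_EFinP.
by rewrite !cLnormE int_tau.
Qed.

Let cLnorm_comp_lty (f : LpFun) : (cLnorm mu p (f \o tau) < +oo)%E.
Proof. by rewrite cLnorm_comp LpFun_finite. Qed.

Definition comp_LpFun (f : LpFun) : LpFun :=
  to_LpFun p1 (cmeasurable_comp f) (cLnorm_comp_lty f).

Lemma comp_LpFunE (f : LpFun) x : comp_LpFun f x = f (tau x).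
Proof. by []. Qed.

Let comp_LpFun_linear : linear comp_LpFun.
Proof.
move=> a f g; apply: LpFunP => x.
by rewrite comp_LpFunE !LpFun_addE !LpFun_scaleE !comp_LpFunE.
Qed.

Definition comp_Lp (u : Lp) : Lp := pi_Lp (comp_LpFun (repr u)).

Lemma comp_LpE (f : LpFun) : comp_Lp (pi_Lp f) = pi_Lp (comp_LpFun f).
Proof.
apply/pi_LpP.
have /pi_LpP[N [mN N0 fN]] : pi_Lp (repr (pi_Lp f)) = pi_Lp f.
  exact: repr_quotmodK.
exists (tau @^-1` N); split; first by rewrite -[X in measurable X]setTI; exact: mtau.
  by rewrite -N0; exact: mu_tau.
by move=> x /= fx; apply: fN => /= fN; apply: fx => _; exact: fN.
Qed.

Let comp_Lp_linear : linear comp_Lp.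
Proof.
move=> a u v; have [f <-] := pi_Lp_surj u; have [g <-] := pi_Lp_surj v.
by rewrite -linearP !comp_LpE comp_LpFun_linear linearP.
Qed.

Let comp_Lp_bounded : exists M : R, forall u, rnorm (comp_Lp u) <= M * rnorm u.
Proof.
exists 1 => u; have [f <-] := pi_Lp_surj u; rewrite mul1r comp_LpE.
rewrite -[rnorm _]/(Lp_norm _) -[leRHS]/(Lp_norm _) !Lp_normE.
by rewrite -[X in fine X <= _]/(cLnorm mu p (f \o tau)) cLnorm_comp.
Qed.

Definition composition_operator : Bop Lp := to_Bop comp_Lp_linear comp_Lp_bounded.

Lemma composition_operatorE (f : LpFun) :
  composition_operator (pi_Lp f) = pi_Lp (comp_LpFun f).
Proof. exact: comp_LpE. Qed.

End CompositionOperator.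

(* Z carries the discrete sigma-algebra, as nat does in the library.           *)
HB.instance Definition _ := isPointed.Build int 0.
HB.instance Definition _ := @isMeasurable.Build default_measure_display
  int discrete_measurable discrete_measurable0
  discrete_measurableC discrete_measurableU.

Lemma counting_preimage (T : choiceType) (R : realType) (f g : T -> T)
    (X : set T) : cancel f g -> cancel g f ->
  counting (f @^-1` X) = counting X :> \bar R.
Proof.
move=> fK gK; have -> : f @^-1` X = g @` X.
  apply/seteqP; split=> [x Xfx|_ [x Xx <-]] /=; last by rewrite gK.
  by exists (f x).
have [finX|infX] := pselect (finite_set X).
  rewrite /counting !asboolT//; last exact: finite_image.
  by rewrite fset_set_image// finmap.card_imfset//; exact: can_inj gK.
rewrite /counting !asboolF// => /(finite_image f).
rewrite image_comp (_ : f \o g = id) ?image_id//.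
by apply/funext => x /=.
Qed.

Section ShiftAlgebra.
Context (R : realType).

Definition counting_int : {measure set int -> \bar R} := @counting int R.

(* l^1(Z) is L^1 of Z for the counting measure.                                *)
Definition l1Z : Type := Lp counting_int (lexx (1 : R)).

HB.instance Definition _ := NormedModule.on l1Z.

Let measurable_int (f : int -> int) : measurable_fun [set: int] f.
Proof. by []. Qed.

Let prevK : cancel (fun n : int => n - 1) (fun n => n + 1).
Proof. by move=> n; rewrite subrK. Qed.

Let nextK : cancel (fun n : int => n + 1) (fun n => n - 1).
Proof. by move=> n; rewrite addrK. Qed.

Let counting_prev (X : set int) : measurable X ->
  counting_int ((fun n => n - 1) @^-1` X) = counting_int X.
Proof. by move=> _; exact: counting_preimage prevK nextK. Qed.

Let counting_next (X : set int) : measurable X ->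
  counting_int ((fun n => n + 1) @^-1` X) = counting_int X.
Proof. by move=> _; exact: counting_preimage nextK prevK. Qed.

Definition bilateral_shift : Bop l1Z :=
  composition_operator (lexx (1 : R)) (@measurable_int (fun n => n - 1))
    counting_prev.

Definition inverse_bilateral_shift : Bop l1Z :=
  composition_operator (lexx (1 : R)) (@measurable_int (fun n => n + 1))
    counting_next.

Definition next_comp (f : LpFun counting_int (lexx (1 : R))) :=
  comp_LpFun (@measurable_int (fun n => n + 1)) counting_next f.

Definition prev_comp (f : LpFun counting_int (lexx (1 : R))) :=
  comp_LpFun (@measurable_int (fun n => n - 1)) counting_prev f.

Lemma bilateral_shiftE f : bilateral_shift (pi_Lp f) = pi_Lp (prev_comp f).
Proof. exact: composition_operatorE. Qed.

Lemma inverse_bilateral_shiftE f :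
  inverse_bilateral_shift (pi_Lp f) = pi_Lp (next_comp f).
Proof. exact: composition_operatorE. Qed.

Lemma prev_compE f n : prev_comp f n = f (n - 1).
Proof. by []. Qed.

Lemma next_compE f n : next_comp f n = f (n + 1).
Proof. by []. Qed.

Lemma bilateral_shiftK : cancel bilateral_shift inverse_bilateral_shift.
Proof.
move=> u; have [f <-] := pi_Lp_surj u.
rewrite bilateral_shiftE inverse_bilateral_shiftE; congr (pi_Lp _).
by apply: LpFunP => n; rewrite next_compE prev_compE addrK.
Qed.

Lemma inverse_bilateral_shiftK : cancel inverse_bilateral_shift bilateral_shift.
Proof.
move=> u; have [f <-] := pi_Lp_surj u.
rewrite inverse_bilateral_shiftE bilateral_shiftE; congr (pi_Lp _).
by apply: LpFunP => n; rewrite prev_compE next_compE subrK.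
Qed.

Definition F1Z : normedAlgType R[i] :=
  subAlg (generated_subalgebra [set bilateral_shift; inverse_bilateral_shift]).

End ShiftAlgebra.

(* The homomorphism is not required to preserve units. A measurableType is     *)
(* pointed; the L^p-space of the empty measure space, which is zero, is also   *)
(* that of a point with the zero measure.                                      *)
Definition acts_on_Lp (R : realType) (A : normedAlgType R[i]) (p : R)
    (p1 : 1 <= p) : Prop :=
  exists (d : measure_display) (T : measurableType d)
    (mu : {measure set T -> \bar R}) (phi : A -> Bop (Lp mu p1)),
    isometric_homomorphism phi.

Arguments acts_on_Lp {R} A p p1.

(* Main.v *)
Require Import Defs.
From HB Require Import structures.
From mathcomp Require Import all_boot all_order all_algebra.
From mathcomp Require Import finmap.
From mathcomp Require Import all_classical all_reals all_analysis.
From mathcomp Require Import measurable_realfun complex ring lra.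

Set Implicit Arguments.
Unset Strict Implicit.
Unset Printing Implicit Defensive.

Import Order.TTheory GRing.Theory Num.Theory.
Import numFieldNormedType.Exports.

Local Open Scope classical_set_scope.
Local Open Scope ring_scope.
Local Open Scope complex_scope.

(** The quotient is the one in which the class u of the bilateral shift has
    spectrum {1, omega}, where omega is a primitive cube root of unity: it
    satisfies (u - 1) (u - omega) = 0 or, up to the factor omega^2,
    1 + omega u + omega^2 u^2 = 0. Everything is decided by the norm of
    1 - omega u.

    In the quotient this norm is 2. The functional that sends 1 to 1, u to
    - omega^2 and u^2 to 0 is compatible with the relation, is bounded by 1 on
    all powers of u, hence has norm 1, and takes the value 2 at 1 - omega u
    ([cube_functional_far]).

    On an L^p-space it is always smaller than 2 ([cube_relation_opnorm_lt2]).
    Let e, u be operators that represent 1, u; they are contractions, with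
    u^3 = e, and e need not be the identity. Only vectors a = e a matter.

    If 1 < p, put v = - omega u a. Then v has the norm of a and, by the
    relation, a - v = - omega^2 u^2 a has it as well. An L^p-space is uniformly
    convex, so the norm of a + v = (1 - omega u) a is at most th times that of
    a, for some th < 2 that depends on p only ([Lp_nonsquare]).

    If p = 1, decompose a = y + z into eigenvectors for 1 and omega. A
    contraction of L^1 that preserves the norm of y cannot create cancellation
    between the pieces h y and (1 - h) y, for 0 <= h <= 1, so it maps h y to a
    real multiple of the image of y ([L1_contraction_multiple]). Applied to e,
    u and u^2, and combined with the relation, whose coefficients are the three
    cube roots of unity, this gives u (h y) = e (h y) for every bounded h, and
    likewise u (h z) = omega e (h z) ([eigenvector_multiple]). A function that
    is a multiple of both y and z is therefore killed by e, although e is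
    isometric on the positive multiples of y: y and z are disjointly supported
    ([eigenvectors_disjoint]). Hence the norm of 1 - omega u is at most the
    maximum of |1 - omega| and |1 - omega^2|, that is, sqrt 3.

    The algebra F^1(Z) is defined by its action on l^1(Z), an L^1-space, so
    closure under quotients fails as soon as F^1(Z) is known to be a Banach
    algebra; its completeness comes down to that of l^1(Z)
    ([l1Z_rcomplete]). *)

(** * The modulus of a complex number *)

Lemma normcN (R : rcfType) (a : R[i]) : Normc.normc (- a) = Normc.normc a.
Proof. by case: a => x y /=; rewrite !sqrrN. Qed.

Lemma normc_real (R : realType) (a : R) : 0 <= a -> Normc.normc a%:C = a.
Proof. by move=> a0; rewrite /= expr0n addr0 sqrtr_sqr ger0_norm. Qed.

Lemma normc_Re_Im (R : realType) (z : R[i]) :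
  `|complex.Re z| <= Normc.normc z /\ `|complex.Im z| <= Normc.normc z.
Proof.
case: z => x y /=; rewrite -!sqrtr_sqr; split; apply: ler_wsqrtr.
  by rewrite lerDl sqr_ge0.
by rewrite lerDr sqr_ge0.
Qed.

Lemma normc_parallelogram (R : realType) (a b : R[i]) : Normc.normc (a + b) ^+ 2 +
  Normc.normc (a - b) ^+ 2 = 2 * (Normc.normc a ^+ 2 + Normc.normc b ^+ 2).
Proof.
case: a b => [a1 a2] [b1 b2] /=.
by rewrite !sqr_sqrtr ?addr_ge0 ?sqr_ge0//; ring.
Qed.

(** Equality in the triangle inequality forces a and b onto a common ray. *)
Lemma normc_add_colinear (R : realType) (a b : R[i]) :
  Normc.normc a + Normc.normc b <= Normc.normc (a + b) ->
  exists k : R, a = k%:C * (a + b).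
Proof.
move=> h; have hab : Normc.normc (a + b) = Normc.normc a + Normc.normc b.
  by apply/le_anti; rewrite h le_normcD.
have [ab0|ab0] := eqVneq (a + b) 0.
  exists 0; rewrite mul0r; apply: Normc.eq0_normc.
  move: hab (normc_ge0 a) (normc_ge0 b); rewrite ab0 Normc.normc0; lra.
have s0 : 0 < Normc.normc (a + b).
  rewrite lt_neqAle normc_ge0 andbT eq_sym.
  by apply: contra ab0 => /eqP/Normc.eq0_normc ->.
exists (Normc.normc a / Normc.normc (a + b)).
move: hab (normc_ge0 a) (normc_ge0 b) s0.
have sq (z : R[i]) : Normc.normc z ^+ 2 = complex.Re z ^+ 2 + complex.Im z ^+ 2.
  by case: z => x y /=; rewrite sqr_sqrtr ?addr_ge0 ?sqr_ge0.
move: (sq a) (sq b) (sq (a + b)); set s := Normc.normc a; set t := Normc.normc b.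
set v := Normc.normc (a + b).
move: (s) (t) (v); clear; case: a b => [a1 a2] [b1 b2] /= {}s {}t {}v hs ht hv hv' s0 t0 v0.
(* The inner product of a and b is s t, hence |t a - s b|^2 = 0. *)
have dot : a1 * b1 + a2 * b2 = s * t.
  move: hv; rewrite hv' => hv; nra.
have z1 : t * a1 = s * b1 /\ t * a2 = s * b2.
  have : (t * a1 - s * b1) ^+ 2 + (t * a2 - s * b2) ^+ 2 = 0.
    transitivity (t ^+ 2 * (a1 ^+ 2 + a2 ^+ 2) + s ^+ 2 * (b1 ^+ 2 + b2 ^+ 2)
      - 2 * s * t * (a1 * b1 + a2 * b2)); first by ring.
    by rewrite -hs -ht dot; ring.
  by move/eqP; rewrite paddr_eq0 ?sqr_ge0// !sqrf_eq0 !subr_eq0 => /andP[/eqP ? /eqP ?].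
case: z1 => z1 z2.
apply/eqP; rewrite eq_complex /= !mul0r subr0 addr0; apply/andP; split; apply/eqP.
  rewrite mulrAC; apply: (mulIf (lt0r_neq0 v0)); rewrite divfK ?gt_eqF// hv'; lra.
rewrite mulrAC; apply: (mulIf (lt0r_neq0 v0)); rewrite divfK ?gt_eqF// hv'; lra.
Qed.

(** * Uniform convexity *)

Section UniformConvexity.
Context (R : realType) (p : R) (p_gt1 : 1 < p).
Implicit Types (s t r : R) (a b : R[i]).

Let p_gt0 : 0 < p. Proof. exact: lt_trans ltr01 p_gt1. Qed.

Lemma powR_homo s t : 0 <= s -> s <= t -> s `^ p <= t `^ p.
Proof.
move=> s0 st; apply: (ge0_ler_powR (ltW p_gt0)); rewrite ?nnegrE//.
exact: le_trans st.
Qed.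

(** The inequality of Young applied to t and 1. *)
Lemma bernoulli_powR t : 0 <= t -> 1 + p * (t - 1) <= t `^ p.
Proof.
move=> t0; pose q := p / (p - 1).
have pB1 : 0 < p - 1 by rewrite subr_gt0.
have q0 : 0 < q by rewrite divr_gt0.
have pq : p^-1 + q^-1 = 1 by rewrite /q; field; rewrite !gt_eqF.
have := conjugate_powR t0 ler01 p_gt0 q0 pq.
rewrite mulr1 powR1 div1r => h.
have -> : 1 + p * (t - 1) = p * (t - q^-1) by rewrite /q; field; rewrite !gt_eqF.
by rewrite mulrC -ler_pdivlMr// lerBlDr.
Qed.

(** Squaring the inequality of Bernoulli for sqrt t gives it back for t, with
    a surplus that measures the distance from t to 1. *)
Lemma bernoulli_powR_gap t : 1 <= t ->
  1 + p * (t - 1) + p * (p - 1) * (Num.sqrt t - 1) ^+ 2 <= t `^ p.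
Proof.
move=> t1; have t0 : 0 <= t := le_trans ler01 t1.
set s := Num.sqrt t; have s0 : 0 <= s := sqrtr_ge0 _.
have ss : s * s = t by rewrite -expr2 sqr_sqrtr.
have s1 : 1 <= s by rewrite -sqrtr1 ler_wsqrtr.
rewrite -[in leRHS]ss powRM//.
have h := bernoulli_powR s0.
have h0 : 0 <= 1 + p * (s - 1) by rewrite addr_ge0 ?mulr_ge0 ?subr_ge0 ?(ltW p_gt0)//.
apply: le_trans (ler_pM h0 h0 h h).
by rewrite -ss le_eqVlt; apply/orP; left; apply/eqP; ring.
Qed.

(** Both midpoint inequalities below are homogeneous in (s, t); this reduces
    them to the case of mean 1, where the inequality of Bernoulli applies. *)
Lemma powR_midpoint_scale s t g : 0 <= s -> 0 <= t -> 0 < s + t ->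
  let m := (s + t) / 2 in 2 * g <= (s / m) `^ p + (t / m) `^ p ->
  g * (s + t) `^ p <= 2 `^ (p - 1) * (s `^ p + t `^ p).
Proof.
move=> s0 t0 st0 m; have m0 : 0 < m by rewrite divr_gt0.
have m_ge0 : 0 <= m := ltW m0.
have e : s + t = 2 * m by rewrite /m mulrC divfK.
clearbody m => gm.
have scale r : 0 <= r -> r `^ p = m `^ p * (r / m) `^ p.
  by move=> r0; rewrite -powRM // ?divr_ge0 // mulrC divfK ?gt_eqF.
rewrite e powRM// (scale s)// (scale t)// -mulrDr.
have -> : g * (2 `^ p * m `^ p) = 2 `^ (p - 1) * (m `^ p * (2 * g)).
  by rewrite -(mulr_powRB1 (ler0n R 2) p_gt0); ring.
by rewrite ler_wpM2l ?powR_ge0// ler_wpM2l ?powR_ge0.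
Qed.

Lemma powR_midpoint s t : 0 <= s -> 0 <= t ->
  (s + t) `^ p <= 2 `^ (p - 1) * (s `^ p + t `^ p).
Proof.
move=> s0 t0; have [st0|st0] := eqVneq (s + t) 0.
  by rewrite st0 powR0 ?gt_eqF// mulr_ge0 ?addr_ge0 ?powR_ge0.
have st : 0 < s + t by rewrite lt_neqAle eq_sym st0 addr_ge0.
rewrite -[leLHS]mul1r; apply: powR_midpoint_scale => //.
set m := (s + t) / 2; have m0 : 0 < m by rewrite divr_gt0.
have stm : s / m + t / m = 2 by rewrite -mulrDl /m invf_div mulrC divfK.
clearbody m.
have hs : 0 <= s / m by rewrite divr_ge0// ltW.
have ht : 0 <= t / m by rewrite divr_ge0// ltW.
apply: le_trans (lerD (bernoulli_powR hs) (bernoulli_powR ht)).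
by rewrite addrACA -mulrDr addrACA stm; lra.
Qed.

(** Strict convexity, made uniform on a cone that avoids the diagonal s = t.
    *)
Lemma powR_midpoint_gap r : 0 <= r < 1 ->
  exists2 th : R, 0 <= th < 1 & forall s t, 0 <= s -> 0 <= t <= r * s ->
    (s + t) `^ p <= th * (2 `^ (p - 1) * (s `^ p + t `^ p)).
Proof.
move=> /andP[r0 r1].
have r1p : 0 < 1 + r by rewrite ltr_wpDr.
pose eta := Num.sqrt (2 / (1 + r)) - 1.
have eta0 : 0 < eta.
  by rewrite subr_gt0 -[ltLHS]sqrtr1 ltr_sqrt ?divr_gt0// ltr_pdivlMr//; lra.
pose g := 1 + p * (p - 1) / 2 * eta ^+ 2.
have g1 : 1 < g.
  by rewrite ltrDl mulr_gt0 ?exprn_gt0// divr_gt0// mulr_gt0// subr_gt0.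
have g0 : 0 < g := lt_trans ltr01 g1.
exists g^-1; first by rewrite invr_ge0 ltW//= invf_lt1.
move=> s t; rewrite le_eqVlt => /predU1P[<-|s0].
  rewrite mulr0 => /le_anti <-; rewrite addr0 powR0 ?gt_eqF//.
  by rewrite addr0 !mulr0.
move=> /andP[t0 trs]; have st0 : 0 < s + t by rewrite ltr_wpDr.
rewrite ler_pdivlMl//; apply: powR_midpoint_scale => //; first exact: ltW.
set m := (s + t) / 2; have m0 : 0 < m by rewrite divr_gt0.
have e : s + t = 2 * m by rewrite /m mulrC divfK.
have stm : s / m + t / m = 2 by rewrite -mulrDl e mulfK// gt_eqF.
clearbody m.
have sm1 : 2 / (1 + r) <= s / m.
  rewrite ler_pdivrMr// mulrAC ler_pdivlMr// -e; lra.
have sm2 : 1 <= s / m.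
  by apply: le_trans sm1; rewrite ler_pdivlMr//; lra.
have h3 : eta ^+ 2 <= (Num.sqrt (s / m) - 1) ^+ 2.
  have h4 : eta <= Num.sqrt (s / m) - 1 by rewrite lerB// ler_wsqrtr.
  by rewrite ler_sqr// nnegrE ?(le_trans _ h4)// ltW.
have h5 : p * (p - 1) * eta ^+ 2 <= p * (p - 1) * (Num.sqrt (s / m) - 1) ^+ 2.
  by rewrite ler_wpM2l// mulr_ge0 ?ltW// subr_gt0.
have ht : 0 <= t / m by rewrite divr_ge0// ltW.
apply: le_trans (lerD (bernoulli_powR_gap sm2) (bernoulli_powR ht)).
apply: le_trans (lerD (lerD (lexx _) h5) (lexx _)).
have -> : t / m = 2 - s / m by rewrite -stm addrAC subrr add0r.
by rewrite /g le_eqVlt; apply/orP; left; apply/eqP; field; rewrite gt_eqF.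
Qed.

(** Uniform convexity of the plane with its p-th power: if a - b is not small
    compared to a and b, the convexity inequality for a + b is strict by a
    fixed factor. Either the moduli of a and b differ, and the gain comes from
    the strict convexity of the power, or they are close, and the gain comes
    from the parallelogram law. *)
Lemma normc_powR_dichotomy : exists2 th : R, 0 <= th < 1 & forall a b,
  Normc.normc (a - b) `^ p
    <= 4^-1 * (Normc.normc a `^ p + Normc.normc b `^ p) \/
  Normc.normc (a + b) `^ p
    <= th * (2 `^ (p - 1) * (Normc.normc a `^ p + Normc.normc b `^ p)).
Proof.
(* The first alternative holds unless k |a| <= |a - b|, for |b| <= |a|. *)
pose k : R := 4^-1 `^ p^-1.
have k0 : 0 < k by rewrite powR_gt0// invr_gt0.
have kp : k `^ p = 4^-1 by rewrite /k -powRrM mulVf ?gt_eqF// powRr1 ?invr_ge0.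
have k1 : k <= 1.
  rewrite leNgt; apply/negP => k1.
  have : 1 `^ p < k `^ p by apply: gt0_ltr_powR; rewrite ?nnegrE// ltW.
  by rewrite kp powR1; lra.
have [th1 /andP[th10 th11] hth1] : exists2 th : R, 0 <= th < 1 &
    forall s t, 0 <= s -> 0 <= t <= (1 - k / 2) * s ->
    (s + t) `^ p <= th * (2 `^ (p - 1) * (s `^ p + t `^ p)).
  by apply: powR_midpoint_gap; lra.
(* Gain of the parallelogram law when |a| and |b| differ by at most k |a| / 2. *)
pose q := Num.sqrt (1 - 3 / 16 * k ^+ 2).
have k21 : k ^+ 2 <= 1 by rewrite expr_le1// ltW.
have k20 : 0 < k ^+ 2 by rewrite exprn_gt0.
have q1 : q < 1 by rewrite -[ltRHS]sqrtr1 ltr_sqrt//; lra.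
have q0 : 0 <= q by exact: sqrtr_ge0.
have qp1 : q `^ p < 1.
  have -> : 1 = 1 `^ p :> R by rewrite powR1.
  by apply: gt0_ltr_powR; rewrite ?nnegrE.
exists (Num.max th1 (q `^ p)); first by rewrite le_max th10/= gt_max th11.
move=> a b; wlog ba : a b / Normc.normc b <= Normc.normc a.
  move=> H; have [/H//|/ltW/H] := leP (Normc.normc b) (Normc.normc a).
  rewrite [Normc.normc b `^ p + _]addrC [b + a]addrC.
  have -> // : Normc.normc (b - a) = Normc.normc (a - b).
  by rewrite -opprB normcN.
set N := _ `^ p + _ `^ p.
have N0 : 0 <= 2 `^ (p - 1) * N by rewrite mulr_ge0 ?addr_ge0 ?powR_ge0.
have a0 := normc_ge0 a; have b0 := normc_ge0 b.
have [?|hab] := leP (Normc.normc (a - b) `^ p) (4^-1 * N); [by left|right].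
have kab : k * Normc.normc a <= Normc.normc (a - b).
  rewrite leNgt; apply/negP => h; move: hab; rewrite ltNge => /negP; apply.
  apply: (@le_trans _ _ ((k * Normc.normc a) `^ p)).
    by apply: powR_homo (ltW h); exact: normc_ge0.
  rewrite powRM ?(ltW k0)// kp ler_wpM2l ?invr_ge0// /N lerDl powR_ge0//.
have tri : Normc.normc (a + b) <= Normc.normc a + Normc.normc b.
  exact: le_normcD.
have [bs|bs] := leP (Normc.normc b) ((1 - k / 2) * Normc.normc a).
  apply: (@le_trans _ _ ((Normc.normc a + Normc.normc b) `^ p)).
    by apply: powR_homo => //; exact: normc_ge0.
  apply: (@le_trans _ _ (th1 * (2 `^ (p - 1) * N))).
    by apply: hth1 => //; rewrite b0.
  by rewrite ler_wpM2r// le_max lexx.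
apply: (@le_trans _ _ ((q * (Normc.normc a + Normc.normc b)) `^ p)).
  apply: powR_homo; first exact: normc_ge0.
  rewrite -ler_sqr ?nnegrE ?mulr_ge0 ?addr_ge0 ?normc_ge0//.
  rewrite exprMn sqr_sqrtr; last by lra.
  have := normc_parallelogram a b.
  have : (k * Normc.normc a) ^+ 2 <= Normc.normc (a - b) ^+ 2.
    by rewrite ler_sqr ?nnegrE ?normc_ge0 ?mulr_ge0// ltW.
  move: (Normc.normc (a + b)) (Normc.normc (a - b)) => u v.
  move: (Normc.normc a) (Normc.normc b) a0 b0 ba bs => s t s0 t0 ts bs h par.
  have -> : u ^+ 2 = 2 * (s ^+ 2 + t ^+ 2) - v ^+ 2 by rewrite -par addrK.
  have h1 : (s - t) ^+ 2 <= (k * s / 2) ^+ 2.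
    by rewrite ler_sqr ?nnegrE ?divr_ge0 ?mulr_ge0 ?subr_ge0// ?ltW//; lra.
  have h2 : k ^+ 2 * (s + t) ^+ 2 <= k ^+ 2 * (2 * s) ^+ 2.
    by rewrite ler_pM2l// ler_sqr ?nnegrE ?addr_ge0 ?mulr_ge0//; lra.
  nra.
rewrite powRM ?addr_ge0//.
apply: (@le_trans _ _ (q `^ p * (2 `^ (p - 1) * N))).
  by rewrite ler_wpM2l ?powR_ge0// powR_midpoint.
by rewrite ler_wpM2r// le_max lexx orbT.
Qed.

(** The dichotomy as a single inequality, linear in p-th powers of moduli, so
    that it can be integrated. The constant 1/4 leaves room for
    [Lp_nonsquare]. *)
Lemma normc_powR_clarkson : exists2 C : R, 1 <= C & forall a b,
  Normc.normc (a - b) `^ p + C * Normc.normc (a + b) `^ p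
    <= (4^-1 + C * 2 `^ (p - 1)) * (Normc.normc a `^ p + Normc.normc b `^ p).
Proof.
have [th /andP[th0 th1] H] := normc_powR_dichotomy.
have d0 : 0 < 1 - th by rewrite subr_gt0.
exists (1 - th)^-1; first by rewrite invf_ge1//; lra.
move=> a b; set N := _ `^ p + _ `^ p.
have N0 : 0 <= N by rewrite addr_ge0 ?powR_ge0.
have mid (z : R[i]) : Normc.normc z <= Normc.normc a + Normc.normc b ->
    Normc.normc z `^ p <= 2 `^ (p - 1) * N.
  move=> h; apply: (@le_trans _ _ ((Normc.normc a + Normc.normc b) `^ p)).
    by apply: powR_homo => //; exact: normc_ge0.
  by apply: powR_midpoint; exact: normc_ge0.
have hD : Normc.normc (a + b) `^ p <= 2 `^ (p - 1) * N.
  by apply: mid; exact: le_normcD.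
have hB : Normc.normc (a - b) `^ p <= 2 `^ (p - 1) * N.
  apply: mid; apply: le_trans (le_normcD _ _) _.
  by rewrite lerD2l normcN.
rewrite mulrDl -mulrA.
have [h|h] := H a b.
  by apply: lerD => //; rewrite ler_wpM2l// invr_ge0 ltW.
have k0 : 0 <= (1 - th)^-1 by rewrite invr_ge0 ltW.
apply: le_trans (lerD hB (ler_wpM2l k0 h)) _.
rewrite -[leLHS]add0r; apply: lerD; first by rewrite mulr_ge0// invr_ge0.
rewrite le_eqVlt; apply/orP; left; apply/eqP.
move: (2 `^ (p - 1) * N) => M.
by rewrite -[M in M + _](mulKf (lt0r_neq0 d0)) -mulrDr mulrBl mul1r subrK.
Qed.

End UniformConvexity.

Section LpIntegral.
Context d (T : measurableType d) (R : realType).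
Context (mu : {measure set T -> \bar R}) (p : R) (p1 : 1 <= p).
Implicit Types (f g : LpFun mu p1).

Let p_gt0 : 0 < p. Proof. exact: lt_le_trans p1. Qed.

Lemma LpFun_powR_integrable f :
  mu.-integrable [set: T] (EFin \o (fun x => Normc.normc (f x) `^ p)).
Proof.
apply/integrableP; split.
  apply/measurable_EFinP; apply: (@measurableT_comp _ _ _ _ _ _ (@powR R ^~ p)).
    exact: measurable_powR.
  exact/measurable_normc/LpFun_measurable.
have := LpFun_finite f; rewrite cLnormE => /lty_poweRy.
move=> /(_ (lt0r_neq0 _)); rewrite invr_gt0 => /(_ p_gt0).
congr (_ < _)%E; apply: eq_integral => x _.
by rewrite [RHS]gee0_abs/= ?lee_fin ?powR_ge0// ger0_norm// normc_ge0.
Qed.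

Lemma Lp_norm_powR f :
  Lp_norm (pi_Lp f) `^ p = Rintegral mu [set: T] (fun x => Normc.normc (f x) `^ p).
Proof.
rewrite Lp_normE cLnormE /Rintegral.
have -> : (\int[mu]_x (`|Normc.normc (f x)| `^ p)%:E =
           \int[mu]_x (Normc.normc (f x) `^ p)%:E)%E.
  by apply: eq_integral => x _; rewrite ger0_norm// normc_ge0.
have := integrable_fin_num measurableT (LpFun_powR_integrable f).
have : (0 <= \int[mu]_x (Normc.normc (f x) `^ p)%:E)%E.
  by apply: integral_ge0 => x _; rewrite lee_fin powR_ge0.
rewrite /=; case: (\int[mu]_x _)%E => [r|//|//] r0 _.
by rewrite poweR_EFin/= -powRrM mulVf ?gt_eqF// powRr1.
Qed.

End LpIntegral.

Section LpUniformConvexity.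
Context d (T : measurableType d) (R : realType).
Context (mu : {measure set T -> \bar R}) (p : R) (p1 : 1 <= p) (p_gt1 : 1 < p).

Let p_gt0 : 0 < p. Proof. exact: lt_trans ltr01 p_gt1. Qed.

(** Integrating [normc_powR_clarkson]: when u, v and u - v have comparable
    norms, the term |u - v|^p exceeds the error 1/4 (|u|^p + |v|^p) by a
    definite amount, which has to be made up by u + v. *)
Lemma Lp_nonsquare : exists2 th : R, 0 <= th < 2 & forall u v : Lp mu p1,
  rnorm v <= rnorm u -> rnorm u <= rnorm (u - v) ->
  rnorm (u + v) <= th * rnorm u.
Proof.
have [C C1 HC] := normc_powR_clarkson p_gt1.
have C0 : 0 < C := lt_le_trans ltr01 C1.
pose t : R := 2 `^ p - (2 * C)^-1.
have t2p : t < 2 `^ p by rewrite /t ltrBlDr ltrDl invr_gt0 mulr_gt0.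
have t0 : 0 <= t.
  have : 1 <= 2 `^ p :> R by have := powR_homo p_gt1 ler01 (ler1n R 2); rewrite powR1.
  have : (2 * C)^-1 <= 1 by rewrite invf_le1 ?mulr_gt0//; lra.
  by rewrite /t; lra.
exists (t `^ p^-1).
  rewrite powR_ge0/= ltNge; apply/negP => /(powR_homo p_gt1 (ler0n R 2)).
  by rewrite -powRrM mulVf ?gt_eqF// powRr1// leNgt t2p.
move=> u v; have [f <-] := pi_Lp_surj u; have [g <-] := pi_Lp_surj v.
rewrite -linearB -linearD ![rnorm _]/(Lp_norm _) => gf fg.
pose I (h : LpFun mu p1) := Rintegral mu [set: T] (fun x => Normc.normc (h x) `^ p).
have IE h : Lp_norm (pi_Lp h) `^ p = I h by exact: Lp_norm_powR.
have N0 h : 0 <= Lp_norm (pi_Lp h) by exact: (rnorm_ge0 (pi_Lp h)).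
have gfI : I g <= I f by rewrite -!IE; exact: powR_homo.
have fgI : I f <= I (f - g) by rewrite -!IE; exact: powR_homo.
have ii (h : LpFun mu p1) := LpFun_powR_integrable h.
have main : I (f - g) + C * I (f + g) <= (4^-1 + C * 2 `^ (p - 1)) * (I f + I g).
  rewrite /I -RintegralZl// -!RintegralD//; last first.
    by have := integrableZl measurableT C (ii (f + g)).
  rewrite -RintegralZl//; last by have := integrableD measurableT (ii f) (ii g).
  apply: le_Rintegral => //.
  - have := integrableD measurableT (ii (f - g))
      (integrableZl measurableT C (ii (f + g))).
    by [].
  - have := integrableZl measurableT (4^-1 + C * 2 `^ (p - 1))
      (integrableD measurableT (ii f) (ii g)).
    by [].
  - by move=> x _; exact: HC.
have e2 : 2 `^ p = 2 * 2 `^ (p - 1) :> R by rewrite mulr_powRB1.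
have If0 : 0 <= I f by rewrite -IE powR_ge0.
have key : I (f + g) <= t * I f.
  rewrite -(ler_pM2l C0) /t e2.
  have -> : C * ((2 * 2 `^ (p - 1) - (2 * C)^-1) * I f) =
    (2 * (C * 2 `^ (p - 1)) - 2^-1) * I f by field; rewrite gt_eqF.
  have c0 : 0 <= C * 2 `^ (p - 1) by rewrite mulr_ge0 ?powR_ge0// ltW.
  move: main c0 gfI fgI If0; move: (C * 2 `^ (p - 1)) (C * I (f + g)) (I f) (I g) (I (f - g)).
  by move=> c a b e h; nra.
rewrite leNgt; apply/negP => lt_fg.
have : (t `^ p^-1 * Lp_norm (pi_Lp f)) `^ p < Lp_norm (pi_Lp (f + g)) `^ p.
  apply: (gt0_ltr_powR p_gt0) lt_fg; rewrite nnegrE; last exact: N0.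
  by apply: mulr_ge0; [exact: powR_ge0|exact: N0].
rewrite powRM; [|exact: powR_ge0|exact: N0].
by rewrite -powRrM mulVf ?gt_eqF// powRr1// !IE ltNge key.
Qed.

End LpUniformConvexity.

(** * Cube roots of unity *)

Section CubeRootOfUnity.
Context (R : realType).

Definition omega : R[i] := (- 2^-1) +i* (Num.sqrt 3 / 2).

Let sqrt3 : Num.sqrt 3 * Num.sqrt 3 = 3 :> R.
Proof. by rewrite -expr2 sqr_sqrtr. Qed.

Lemma omega_sqr : omega * omega = - 1 - omega.
Proof.
rewrite /omega; apply/eqP; rewrite eq_complex /=; apply/andP.
by split; apply/eqP; [move: sqrt3; move: (Num.sqrt 3) => s; nra|field].
Qed.

Lemma omega_cube : omega * omega * omega = 1.
Proof. by rewrite omega_sqr mulrBl mulN1r omega_sqr; ring. Qed.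

Lemma normc_omega : Normc.normc omega = 1.
Proof.
rewrite /= (_ : _ + _ = 1) ?sqrtr1//.
by move: sqrt3; move: (Num.sqrt 3) => s; nra.
Qed.

Lemma one_sub_omega_neq0 : 1 - omega != 0.
Proof.
rewrite subr_eq0; apply/negP => /eqP/(congr1 (@complex.Re R)) /=; lra.
Qed.

(** The only real linear relation between the three cube roots of unity is
    that their sum vanishes. *)
Lemma omega_free (a b c : R) :
  a%:C + omega * b%:C + omega * omega * c%:C = 0 -> a = b /\ b = c.
Proof.
rewrite omega_sqr => /eqP; rewrite eq_complex /= => /andP[/eqP h1 /eqP h2].
have s0 : Num.sqrt 3 != 0 :> R by rewrite gt_eqF// sqrtr_gt0.
have bc : b = c.
  apply: (mulfI s0); move: h2; lra.
by split => //; move: h1; rewrite bc; nra.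
Qed.

End CubeRootOfUnity.
Arguments omega {R}.

(** * Multiplication by bounded functions and contractions of L^1 *)

Section Multiplication.
Context d (T : measurableType d) (R : realType).
Implicit Types f g h : T -> R[i].

Lemma cmeasurableM f g : cmeasurable f -> cmeasurable g ->
  cmeasurable (fun x => f x * g x).
Proof.
move=> [fR fI] [gR gI]; split.
  rewrite (_ : _ \o _ = ((@complex.Re R \o f) \* (@complex.Re R \o g)) \-
      ((@complex.Im R \o f) \* (@complex.Im R \o g))).
    by apply: measurable_funB; apply: measurable_funM.
  by apply/funext => x /=; case: (f x) (g x) => [? ?] [].
rewrite (_ : _ \o _ = ((@complex.Re R \o f) \* (@complex.Im R \o g)) \+
    ((@complex.Im R \o f) \* (@complex.Re R \o g))).
  by apply: measurable_funD; apply: measurable_funM.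
by apply/funext => x /=; case: (f x) (g x) => [? ?] [].
Qed.

Lemma cmeasurable_real (h : T -> R) : measurable_fun [set: T] h ->
  cmeasurable (fun x => (h x)%:C).
Proof. by move=> mh; split => //=; exact: measurable_cst. Qed.

Lemma cmeasurable_conj f : cmeasurable f -> cmeasurable (fun x => (f x)^*).
Proof.
move=> [fR fI]; split.
  rewrite (_ : _ \o _ = @complex.Re R \o f)//.
  by apply/funext => x /=; case: (f x).
rewrite (_ : _ \o _ = \- (@complex.Im R \o f)).
  exact: measurableT_comp.
by apply/funext => x /=; case: (f x).
Qed.

Context (mu : {measure set T -> \bar R}) (p : R) (p1 : 1 <= p).

Lemma le_cLnorm f g : cmeasurable f -> cmeasurable g ->
  (forall x, Normc.normc (f x) <= Normc.normc (g x)) ->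
  (cLnorm mu p f <= cLnorm mu p g)%E.
Proof.
move=> mf mg fg; rewrite !cLnormE.
have p0 : 0 <= p by exact: le_trans p1.
have ge0 k : (0 <= \int[mu]_x (`|Normc.normc (k x)| `^ p)%:E)%E.
  by apply: integral_ge0 => x _; rewrite lee_fin powR_ge0.
have mP k : cmeasurable k ->
    measurable_fun [set: T] (fun x => (`|Normc.normc (k x)| `^ p)%:E).
  move=> mk; apply/measurable_EFinP.
  apply: (@measurableT_comp _ _ _ _ _ _ (@powR R ^~ p)).
    exact: measurable_powR.
  by apply: measurableT_comp => //; exact: measurable_normc.
apply: gt0_ler_poweR.
- by rewrite invr_ge0.
- by rewrite in_itv/= leey andbT ge0.
- by rewrite in_itv/= leey andbT ge0.
apply: ge0_le_integral => //.
- exact: mP.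
- exact: mP.
move=> x _; rewrite lee_fin ge0_ler_powR ?nnegrE//.
by rewrite !ger0_norm ?normc_ge0.
Qed.

Lemma LpFun_mul_subproof (h : T -> R[i]) (f : LpFun mu p1) :
  cmeasurable h -> (forall x, Normc.normc (h x) <= 1) ->
  (cLnorm mu p (fun x => h x * f x)%R < +oo)%E.
Proof.
move=> mh h1; apply: le_lt_trans (LpFun_finite f).
apply: le_cLnorm.
- exact: cmeasurableM mh (LpFun_measurable f).
- exact: LpFun_measurable.
- by move=> x; rewrite Normc.normcM ler_piMl ?normc_ge0.
Qed.

Definition LpFun_mul h (mh : cmeasurable h)
    (h1 : forall x, Normc.normc (h x) <= 1) (f : LpFun mu p1) : LpFun mu p1 :=
  to_LpFun p1 (cmeasurableM mh (LpFun_measurable f))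
    (LpFun_mul_subproof f mh h1).

End Multiplication.

Section L1.
Context d (T : measurableType d) (R : realType).
Context (mu : {measure set T -> \bar R}) (one_le1 : 1 <= (1 : R)).
Local Notation F := (LpFun mu one_le1).
Local Notation L1 := (Lp mu one_le1).
Implicit Types (f g : F).

Lemma L1_integrable f :
  mu.-integrable [set: T] (EFin \o (fun x => Normc.normc (f x))).
Proof.
have := LpFun_powR_integrable f; congr (integrable _ _ _).
by apply/funext => x /=; rewrite powRr1 ?normc_ge0.
Qed.

Lemma L1_norm f :
  rnorm (pi_Lp f) = Rintegral mu [set: T] (fun x => Normc.normc (f x)).
Proof.
rewrite -[LHS]powRr1 ?rnorm_ge0// [rnorm _]/(Lp_norm _) Lp_norm_powR.
by apply: eq_Rintegral => x _; rewrite powRr1 ?normc_ge0.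
Qed.

Lemma L1_norm_add f g :
  (forall x, Normc.normc (f x) + Normc.normc (g x) = Normc.normc (f x + g x)) ->
  rnorm (pi_Lp f) + rnorm (pi_Lp g) = rnorm (pi_Lp (f + g)).
Proof.
move=> h; rewrite !L1_norm -RintegralD//; try exact: L1_integrable.
by apply: eq_Rintegral => x _; rewrite h.
Qed.

Lemma L1_norm_add_eq f g :
  rnorm (pi_Lp f) + rnorm (pi_Lp g) <= rnorm (pi_Lp (f + g)) ->
  {ae mu, forall x, Normc.normc (f x) + Normc.normc (g x) <= Normc.normc (f x + g x)}.
Proof.
rewrite !L1_norm => h.
pose D x := Normc.normc (f x) + Normc.normc (g x) - Normc.normc ((f + g : F) x).
have iS := integrableD measurableT (L1_integrable f) (L1_integrable g).
have iD : mu.-integrable [set: T] (EFin \o D).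
  by have := integrableB measurableT iS (L1_integrable (f + g)).
have D0 x : 0 <= D x by rewrite subr_ge0 le_normcD.
have Dint : Rintegral mu [set: T] D = 0.
  have := RintegralB measurableT iS (L1_integrable (f + g)).
  have -> := RintegralD measurableT (L1_integrable f) (L1_integrable g).
  move=> Dint; apply/le_anti/andP; split; last by apply: Rintegral_ge0 => x _; exact: D0.
  by rewrite Dint subr_le0.
have : (\int[mu]_x `|(EFin \o D) x| = 0)%E.
  under eq_integral do rewrite gee0_abs ?lee_fin//.
  by rewrite -(fineK (integrable_fin_num measurableT iD)) -[fine _]/(Rintegral _ _ _) Dint.
move/(ae_eq_integral_abs _ measurableT); move: (measurable_int _ iD) => mD /(_ mD).
apply: filterS => x /(_ I) /= [/eqP]; rewrite subr_eq0 => /eqP.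
by rewrite /= => ->.
Qed.

(** The functions h f and (1 - h) f have norms that add up to that of f. Their
    images have at most these norms and add up to g, which has the norm of f;
    so the triangle inequality between the images is an equality almost
    everywhere, and each image is a real multiple of g. *)
Lemma L1_contraction_multiple (V : L1 -> L1) (lV : linear V)
    (cV : forall x, rnorm (V x) <= rnorm x) f g :
  V (pi_Lp f) = pi_Lp g -> rnorm (pi_Lp g) = rnorm (pi_Lp f) ->
  forall (h : T -> R) (mh : cmeasurable (fun x => (h x)%:C))
    (h1 : forall x, Normc.normc (h x)%:C <= 1), (forall x, 0 <= h x) ->
  let hf := LpFun_mul mh h1 f in
  rnorm (V (pi_Lp hf)) = rnorm (pi_Lp hf) /\
  exists2 k : F, V (pi_Lp hf) = pi_Lp k &
    {ae mu, forall x, exists c : R, k x = c%:C * g x}.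
Proof.
move=> Vf ng h mh h1 h0 hf; pose kf : F := f - hf.
have hle x : h x <= 1 by rewrite -[h x]normc_real.
have hfE x : hf x = (h x)%:C * f x by [].
have kfE x : kf x = (1 - h x)%:C * f x.
  by rewrite rmorphB mulrBl mul1r -hfE.
have hkf : hf + kf = f by rewrite /kf addrC subrK.
have nhk : rnorm (pi_Lp hf) + rnorm (pi_Lp kf) = rnorm (pi_Lp f).
  rewrite L1_norm_add ?hkf// => x; rewrite hfE kfE -mulrDl -rmorphD/= subrKC mul1r.
  by rewrite !Normc.normcM !normc_real ?subr_ge0// -mulrDl subrKC mul1r.
have [a Ea] := pi_Lp_surj (V (pi_Lp hf)).
have [b Eb] := pi_Lp_surj (V (pi_Lp kf)).
have VD x y : V (x + y) = V x + V y by have := lV 1 x y; rewrite !scale1r.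
have Eab : pi_Lp (a + b) = pi_Lp g by rewrite linearD/= Ea Eb -VD -linearD hkf.
have na : rnorm (pi_Lp a) <= rnorm (pi_Lp hf) by rewrite Ea.
have nb : rnorm (pi_Lp b) <= rnorm (pi_Lp kf) by rewrite Eb.
have nab : rnorm (pi_Lp (a + b)) <= rnorm (pi_Lp a) + rnorm (pi_Lp b).
  by rewrite linearD; exact: rnormD.
rewrite Eab ng in nab.
split; first by rewrite -Ea; apply/le_anti; rewrite na/=; lra.
exists a => //.
have := L1_norm_add_eq (f := a) (g := b).
rewrite Eab ng => /(_ ltac:(lra)).
move/pi_LpP: Eab; apply: filterS2 => x /(_ I) abg /normc_add_colinear[c ->].
by exists c; rewrite -abg.
Qed.

End L1.

(** * Disjointness of the eigenvectors of a contraction of L^1 *)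

Section LpFunEval.
Context d (T : measurableType d) (R : realType).
Context (mu : {measure set T -> \bar R}) (p : R) (p1 : 1 <= p).
Implicit Types f g : LpFun mu p1.

Lemma LpFun_mulrE (a : R[i]) f x : (a *: f : LpFun mu p1) x = a * f x.
Proof. by []. Qed.

Lemma LpFun_0E x : (0 : LpFun mu p1) x = 0.
Proof. by []. Qed.

Lemma LpFun_mulE (h : T -> R[i]) (mh : cmeasurable h)
    (h1 : forall x, Normc.normc (h x) <= 1) f x :
  LpFun_mul mh h1 f x = h x * f x.
Proof. by []. Qed.

End LpFunEval.

Section DisjointEigenvectors.
Context d (T : measurableType d) (R : realType).
Context (mu : {measure set T -> \bar R}) (one_le1 : 1 <= (1 : R)).
Local Notation F := (LpFun mu one_le1).
Local Notation L1 := (Lp mu one_le1).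
Implicit Types (f g : F).

Context (e u w : L1 -> L1) (lin_e : linear e) (lin_u : linear u) (lin_w : linear w).
Context (ce : forall x, rnorm (e x) <= rnorm x)
  (cu : forall x, rnorm (u x) <= rnorm x) (cw : forall x, rnorm (w x) <= rnorm x).
Context (rel : forall x, e x + omega *: u x + (omega * omega) *: w x = 0).

(** For e a unit of u and w the square of u: f is fixed by e, and u acts on it
    as lam. *)
Definition cube_eigenvector (lam : R[i]) f := [/\ e (pi_Lp f) = pi_Lp f,
  u (pi_Lp f) = lam *: pi_Lp f & w (pi_Lp f) = (lam * lam) *: pi_Lp f].

(** By [L1_contraction_multiple], e, u and w map h f to c0 f, c1 lam f and c2
    lam^2 f with real functions c0, c1, c2. The relation becomes c0 + (omega
    lam) c1 + (omega lam)^2 c2 = 0 where f does not vanish; as omega lam is a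
    primitive cube root of unity, the three functions agree. *)
Lemma eigenvector_real_multiple lam f : lam = 1 \/ lam = omega ->
  cube_eigenvector lam f ->
  forall (h : T -> R) (mh : cmeasurable (fun x => (h x)%:C))
    (h1 : forall x, Normc.normc (h x)%:C <= 1), (forall x, 0 <= h x) ->
  let hf := LpFun_mul mh h1 f in u (pi_Lp hf) = lam *: e (pi_Lp hf).
Proof.
move=> lamE [ef uf wf] h mh h1 h0 hf.
have nlam : Normc.normc lam = 1.
  by case: lamE => ->; [exact: Normc.normc1|exact: normc_omega].
have nZ (a : R[i]) : Normc.normc a = 1 -> rnorm (pi_Lp (a *: f)) = rnorm (pi_Lp f).
  by move=> a1; rewrite linearZ rnormZ a1 mul1r.
rewrite -!linearZ/= in uf wf.
have [_ [ke Ee ae_e]] := L1_contraction_multiple lin_e ce ef erefl mh h1 h0.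
have [_ [ku Eu ae_u]] := L1_contraction_multiple lin_u cu uf (nZ _ nlam) mh h1 h0.
have nlam2 : Normc.normc (lam * lam) = 1 by rewrite Normc.normcM nlam mul1r.
have [_ [kw Ew ae_w]] := L1_contraction_multiple lin_w cw wf (nZ _ nlam2) mh h1 h0.
have /pi_LpP ae_rel :
    pi_Lp (ke + omega *: ku + (omega * omega) *: kw) = pi_Lp 0.
  by rewrite linear0 -(rel (pi_Lp hf)) Ee Eu Ew !linearD !linearZ.
rewrite Ee Eu -linearZ; apply/pi_LpP.
apply: filterS2 (filterI ae_e ae_u) (filterI ae_w ae_rel) => x [].
move=> [c0 E0] [c1 E1] [[c2 E2] /(_ I) E] _.
rewrite !LpFun_addE !LpFun_mulrE LpFun_0E in E.
rewrite LpFun_mulrE; rewrite LpFun_mulrE in E1; rewrite LpFun_mulrE in E2.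
have [fx0|fx0] := eqVneq (f x) 0; first by rewrite E1 E0 fx0 !mulr0.
have {}E : c0%:C + omega * lam * c1%:C + omega * omega * (lam * lam) * c2%:C = 0.
  by apply: (mulIf fx0); rewrite mul0r -E E0 E1 E2; ring.
suff e01 : c0 = c1 by rewrite E0 E1 e01; ring.
case: lamE E => ->; first by rewrite !mulr1 => /omega_free[].
have -> : omega * omega * (omega * omega) = omega :> R[i].
  by rewrite mulrA omega_cube mul1r.
by rewrite addrAC => /omega_free[-> ->].
Qed.

(** A bounded complex h is a combination of four functions with values in [0,
    1], the positive and negative parts of its real and imaginary parts. *)
Lemma eigenvector_multiple lam f : lam = 1 \/ lam = omega ->
  cube_eigenvector lam f ->
  forall (h : T -> R[i]) (mh : cmeasurable h)
    (h1 : forall x, Normc.normc (h x) <= 1),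
  let hf := LpFun_mul mh h1 f in u (pi_Lp hf) = lam *: e (pi_Lp hf).
Proof.
move=> lamE Ef h mh h1 hf.
pose pos (k : T -> R) x := Num.max (k x) 0.
have part (k : T -> R) : measurable_fun [set: T] k -> (forall x, `|k x| <= 1) ->
    exists2 g : F, u (pi_Lp g) = lam *: e (pi_Lp g) &
      forall x, g x = (pos k x)%:C * f x.
  move=> mk k1.
  have p0 x : 0 <= pos k x by rewrite le_max lexx orbT.
  have mp : cmeasurable (fun x => (pos k x)%:C).
    apply: cmeasurable_real; apply: measurable_maxr => //.
  have p1 x : Normc.normc (pos k x)%:C <= 1.
    by rewrite normc_real// ge_max ler01 andbT (le_trans (ler_norm _)).
  by exists (LpFun_mul mp p1 f) => //; exact: eigenvector_real_multiple.
have [mR mI] := mh.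
have mN (k : T -> R) : measurable_fun [set: T] k ->
    measurable_fun [set: T] (fun x => - k x) by move=> mk; exact: measurableT_comp.
have [a Ea Fa] := part _ mR (fun x => le_trans (normc_Re_Im (h x)).1 (h1 x)).
have [b Eb Fb] := part _ mI (fun x => le_trans (normc_Re_Im (h x)).2 (h1 x)).
have [a' Ea' Fa'] : exists2 g : F, u (pi_Lp g) = lam *: e (pi_Lp g) &
    forall x, g x = (pos (fun x => - complex.Re (h x)) x)%:C * f x.
  apply: part; first exact: mN mR.
  by move=> x; rewrite normrN (le_trans (normc_Re_Im (h x)).1 (h1 x)).
have [b' Eb' Fb'] : exists2 g : F, u (pi_Lp g) = lam *: e (pi_Lp g) &
    forall x, g x = (pos (fun x => - complex.Im (h x)) x)%:C * f x.
  apply: part; first exact: mN mI.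
  by move=> x; rewrite normrN (le_trans (normc_Re_Im (h x)).2 (h1 x)).
have -> : hf = (a + (-1) *: a') + 'i%C *: (b + (-1) *: b').
  apply: LpFunP => x.
  rewrite !(LpFun_addE, LpFun_mulrE, LpFun_mulE) Fa Fb Fa' Fb' /pos /=.
  have posB (r : R) : r%:C = (Num.max r 0)%:C - (Num.max (- r) 0)%:C.
    rewrite -rmorphB; congr _%:C.
    by have [r0|r0] := leP r 0; have [r1|r1] := leP (- r) 0; lra.
  rewrite {1}[h x]complexE (posB (complex.Re (h x))) (posB (complex.Im (h x))).
  by ring.
have comb (s : R[i]) (g1 g2 : F) : u (pi_Lp g1) = lam *: e (pi_Lp g1) ->
    u (pi_Lp g2) = lam *: e (pi_Lp g2) ->
    u (pi_Lp (g1 + s *: g2)) = lam *: e (pi_Lp (g1 + s *: g2)).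
  move=> H1 H2; rewrite addrC linearP lin_u lin_e H1 H2 scalerDr !scalerA.
  by rewrite [lam * s]mulrC.
by apply: (comb); apply: (comb).
Qed.

(** With psi = 1 / (1 + |f|^2 + |g|^2), the function |g|^2 psi f is a multiple
    of f by a function with values in [0, 1], and also a bounded multiple of
    g. So u acts on it both as e and as omega e. Hence e kills it, although e
    preserves its norm. *)
Lemma eigenvectors_disjoint f g : cube_eigenvector 1 f ->
  cube_eigenvector omega g -> {ae mu, forall x, f x * g x = 0}.
Proof.
move=> Ef Eg.
pose q x := 1 + Normc.normc (f x) ^+ 2 + Normc.normc (g x) ^+ 2.
have q1 x : 1 <= q x by rewrite /q -addrA lerDl addr_ge0 ?sqr_ge0.
have q0 x : 0 < q x := lt_le_trans ltr01 (q1 x).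
pose psi x := q x `^ (-1).
have psiE x : psi x = (q x)^-1 by rewrite /psi powR_inv1// ltW.
have psi0 x : 0 < psi x by rewrite psiE invr_gt0.
have mf := LpFun_measurable f; have mg := LpFun_measurable g.
have mpsi : measurable_fun [set: T] psi.
  apply: (@measurableT_comp _ _ _ _ _ _ (@powR R ^~ (-1))).
    exact: measurable_powR.
  apply: measurable_funD; first apply: measurable_funD => //.
    by apply: measurable_funX; exact: measurable_normc.
  by apply: measurable_funX; exact: measurable_normc.
pose h x := Normc.normc (g x) ^+ 2 * psi x.
pose k x := f x * (g x)^* * (psi x)%:C.
have h0 x : 0 <= h x by rewrite mulr_ge0 ?sqr_ge0// ltW.
have mh : cmeasurable (fun x => (h x)%:C).
  apply: cmeasurable_real; apply: measurable_funM => //.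
  by apply: measurable_funX; exact: measurable_normc.
have mk : cmeasurable k.
  apply: cmeasurableM; last exact: cmeasurable_real.
  by apply: cmeasurableM => //; exact: cmeasurable_conj.
have h1 x : Normc.normc (h x)%:C <= 1.
  rewrite normc_real// /h psiE ler_pdivrMr// mul1r /q lerDr.
  by rewrite addr_ge0// sqr_ge0.
have k1 x : Normc.normc (k x) <= 1.
  rewrite /k !Normc.normcM normc_real ?(ltW (psi0 x))// psiE ler_pdivrMr// mul1r.
  have -> : Normc.normc (g x)^* = Normc.normc (g x).
    by case: (g x) => s t /=; rewrite sqrrN.
  rewrite /q; move: (Normc.normc (f x)) (Normc.normc (g x)) => s t; nra.
have hk : LpFun_mul mh h1 f = LpFun_mul mk k1 g.
  apply: LpFunP => x; rewrite !LpFun_mulE.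
  rewrite /h /k rmorphM/=.
  have -> : (Normc.normc (g x) ^+ 2)%:C = g x * (g x)^*.
    case: (g x) => s t /=; rewrite sqr_sqrtr ?addr_ge0 ?sqr_ge0//.
    by apply/eqP; rewrite eq_complex /=; apply/andP; split; apply/eqP; ring.
  by ring.
have Hf : u (pi_Lp (LpFun_mul mh h1 f)) = 1 *: e (pi_Lp (LpFun_mul mh h1 f)).
  by apply: eigenvector_multiple Ef _ _ _; left.
have Hg : u (pi_Lp (LpFun_mul mk k1 g)) =
    omega *: e (pi_Lp (LpFun_mul mk k1 g)).
  by apply: eigenvector_multiple Eg _ _ _; right.
rewrite -hk Hf scale1r in Hg.
have [ef _ _] := Ef.
have [nh _] := L1_contraction_multiple lin_e ce ef erefl mh h1 h0.
have eh0 : e (pi_Lp (LpFun_mul mh h1 f)) = 0.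
  have /eqP : (1 - omega) *: e (pi_Lp (LpFun_mul mh h1 f)) = 0.
    by rewrite scalerBl scale1r -Hg subrr.
  by rewrite scaler_eq0 (negbTE (one_sub_omega_neq0 R)) => /eqP.
rewrite eh0 rnorm0 in nh.
have := rnorm0_eq0 (esym nh).
rewrite -(linear0 (@pi_Lp _ _ _ mu _ one_le1)) => /pi_LpP.
apply: filterS => x /(_ I) hx.
rewrite LpFun_mulE LpFun_0E in hx; move/eqP: hx.
rewrite mulf_eq0 => /orP[|/eqP->]; last by rewrite mul0r.
rewrite -[0]/(0%:C) => /eqP/complexI/eqP.
rewrite mulf_eq0 (gt_eqF (psi0 x)) orbF sqrf_eq0 => /eqP/Normc.eq0_normc ->.
by rewrite mulr0.
Qed.

Lemma eigenvectors_norm f g (a b : R[i]) (M : R) : cube_eigenvector 1 f ->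
  cube_eigenvector omega g -> Normc.normc a <= M -> Normc.normc b <= M ->
  rnorm (a *: pi_Lp f + b *: pi_Lp g) <= M * rnorm (pi_Lp f + pi_Lp g).
Proof.
move=> Ef Eg aM bM; have M0 : 0 <= M := le_trans (normc_ge0 a) aM.
have -> : a *: pi_Lp f + b *: pi_Lp g = pi_Lp (a *: f + b *: g).
  by rewrite linearD !linearZ.
rewrite -linearD !L1_norm -RintegralZl//; last exact: L1_integrable.
rewrite /Rintegral; apply: fine_le.
- by have := integrable_fin_num measurableT (L1_integrable (a *: f + b *: g)).
- have := integrable_fin_num measurableT
    (integrableZl measurableT M (L1_integrable (f + g))).
  by [].
have mP (k : F) : measurable_fun [set: T] (fun x => Normc.normc (k x)).
  exact: measurable_normc (LpFun_measurable k).
apply: ae_ge0_le_integral => //.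
- by move=> x _; rewrite lee_fin normc_ge0.
- exact/measurable_EFinP/mP.
- by move=> x _; rewrite lee_fin mulr_ge0// normc_ge0.
- by apply/measurable_EFinP; apply: measurable_funM => //; exact: mP.
apply: filterS (eigenvectors_disjoint Ef Eg) => x /eqP fg _.
rewrite lee_fin !LpFun_addE !LpFun_mulrE.
move: fg; rewrite mulf_eq0 => /orP[|] /eqP ->.
  by rewrite mulr0 !add0r Normc.normcM ler_wpM2r// normc_ge0.
by rewrite mulr0 !addr0 Normc.normcM ler_wpM2r// normc_ge0.
Qed.

End DisjointEigenvectors.

(** * The obstruction to acting on an L^p-space *)

Section CubeRelation.
Context (R : realType) (E : normedModType R[i]).
Context (e u w : {linear E -> E}).
Context (ue : forall x, u (e x) = u x) (uu : forall x, u (u x) = w x).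
Context (rel : forall x, e x + omega *: u x + (omega * omega) *: w x = 0).

Lemma cube_relation_w x : w x = - (omega *: e x) - (omega * omega) *: u x.
Proof.
have : omega *: (e x + omega *: u x + (omega * omega) *: w x) = 0.
  by rewrite rel scaler0.
rewrite !scalerDr !scalerA mulrA omega_cube scale1r => /eqP.
by rewrite addrC addr_eq0 opprD => /eqP.
Qed.

(** The relation times 1 - omega u is e - u^3 = 0. *)
Lemma cube_relation_cube x : u (w x) = e x.
Proof.
rewrite cube_relation_w linearB linearN !linearZ/= ue uu cube_relation_w.
rewrite opprD !opprK scalerDr !scalerN !scalerA !mulrA omega_cube scale1r mul1r.
by rewrite addrCA addNr addr0.
Qed.

End CubeRelation.

Section Obstruction.
Context (R : realType).

(** In the quotient of F^1(Z) the corresponding norm is 2, so this is what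
    separates the quotient from algebras that act on L^p-spaces. See the
    introduction for the two cases p = 1 and 1 < p. *)
Lemma cube_relation_opnorm_lt2 (p : R) (p1 : 1 <= p) d (T : measurableType d)
  (mu : {measure set T -> \bar R}) (e u w : Bop (Lp mu p1)) :
  (forall x, e (e x) = e x) -> (forall x, e (u x) = u x) ->
  (forall x, u (e x) = u x) -> (forall x, u (u x) = w x) ->
  (forall x, e x + omega *: u x + (omega * omega) *: w x = 0) ->
  opnorm e <= 1 -> opnorm u <= 1 -> opnorm w <= 1 ->
  opnorm (e - omega *: u) < 2.
Proof.
move=> ee eu ue uu rel e1 u1 w1.
have contr (V : Bop (Lp mu p1)) : opnorm V <= 1 -> forall x, rnorm (V x) <= rnorm x.
  move=> V1 x; apply: le_trans (ler_opnorm V x) _.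
  by rewrite ler_piMl ?rnorm_ge0.
have ce := contr _ e1; have cu := contr _ u1; have cw := contr _ w1.
have wE x : w x = - (omega *: e x) - (omega * omega) *: u x.
  exact: (cube_relation_w rel).
have uw x : u (w x) = e x by exact: (cube_relation_cube ue uu rel).
have TE x : (e - omega *: u : Bop (Lp mu p1)) x = e x - omega *: u (e x).
  by rewrite ue.
suff [th th2 H] : exists2 th : R, 0 <= th < 2 &
    forall a, e a = a -> rnorm (a - omega *: u a) <= th * rnorm a.
  move/andP: th2 => [th0 th2]; apply: le_lt_trans th2; apply: opnorm_le => // x.
  by rewrite TE (le_trans (H _ (ee x)))// ler_wpM2l.
have := p1; rewrite le_eqVlt => /predU1P[p_eq1|p_gt1].
  subst p.
  exists (Num.sqrt 3).
    rewrite sqrtr_ge0/= -[ltRHS]ger0_norm// -sqrtr_sqr ltr_sqrt ?exprn_gt0//.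
    by rewrite expr2; lra.
  move=> a ea.
  have uZ b x : u (b *: x) = b *: u x by exact: linearZ.
  have uD x y : u (x + y) = u x + u y by exact: linearD.
  have o1 := one_sub_omega_neq0 R.
  (* The spectral projections of u, applied to a. *)
  pose c : R[i] := (1 - omega)^-1.
  pose y := c *: (u a - omega *: a); pose z := c *: (a - u a).
  have wa : w a = - (omega *: a) - (omega * omega) *: u a by rewrite wE ea.
  have uy : u y = y.
    rewrite /y linearZ/= linearB linearZ/= uu wa omega_sqr; congr (_ *: _).
    by rewrite scalerBl scaleN1r opprD !opprK addrA addrK addrC.
  have uz : u z = omega *: z.
    rewrite /z linearZ/= linearB/= uu wa omega_sqr scalerA [omega * c]mulrC -scalerA.
    congr (_ *: _); rewrite scalerBr scalerBl scaleN1r !opprD !opprK.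
    by rewrite addrCA addNKr.
  have yz : y + z = a.
    rewrite /y /z -scalerDr addrC addrA subrK -[X in X - _]scale1r -scalerBl.
    by rewrite scalerA mulVf// scale1r.
  have ey : e y = y by rewrite /y linearZ/= linearB linearZ/= eu ea.
  have ez : e z = z by rewrite /z linearZ/= linearB/= eu ea.
  have [f fy] := pi_Lp_surj y; have [g gz] := pi_Lp_surj z.
  have Ef : cube_eigenvector e u w 1 f.
    by rewrite /cube_eigenvector fy -uu !uy mul1r scale1r.
  have Eg : cube_eigenvector e u w omega g.
    by split; rewrite gz// -uu uz uZ uz scalerA.
  have -> : a - omega *: u a = (1 - omega) *: pi_Lp f + (1 - omega * omega) *: pi_Lp g.
    rewrite fy gz -{1 2}yz uD uy uz scalerDr scalerA.
    by rewrite !scalerBl !scale1r opprD addrACA.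
  rewrite -[in leRHS]yz -fy -gz.
  apply: (eigenvectors_norm (linearP e) (linearP u) (linearP w)) Ef Eg _ _ => //.
    rewrite [leLHS]/= sub0r sqrrN ler_wsqrtr//.
    have : Num.sqrt 3 * Num.sqrt 3 = 3 :> R by rewrite -expr2 sqr_sqrtr.
    by move: (Num.sqrt 3) => s ss; nra.
  rewrite omega_sqr [leLHS]/= !opprD !opprK ler_wsqrtr//.
  have : Num.sqrt 3 * Num.sqrt 3 = 3 :> R by rewrite -expr2 sqr_sqrtr.
  by move: (Num.sqrt 3) => s ss; nra.
have [th th2 H] := Lp_nonsquare mu p1 p_gt1.
exists th => // a ea; apply: H.
  by rewrite rnormN rnormZ normc_omega mul1r.
rewrite opprK.
have -> : a + omega *: u a = - ((omega * omega) *: w a).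
  by apply/eqP; rewrite -addr_eq0 -{1}ea rel.
rewrite rnormN rnormZ Normc.normcM normc_omega !mul1r.
by rewrite -{1}ea -uw cu.
Qed.

(** A homomorphism sends e to an idempotent, not to the identity of the
    L^p-space; this is why [cube_relation_opnorm_lt2] keeps track of e. *)
Lemma cube_relation_not_acts (B : normedAlgType R[i]) (e u : B) :
  amul e e = e -> amul e u = u -> amul u e = u -> rnorm e <= 1 -> rnorm u <= 1 ->
  e + omega *: u + (omega * omega) *: amul u u = 0 ->
  2 <= rnorm (e - omega *: u) ->
  forall (p : R) (p1 : 1 <= p), ~ acts_on_Lp B p p1.
Proof.
move=> ee eu ue e1 u1 rel n2 p p1 [d [T [mu [phi [lphi mphi iphi]]]]].
have nphi x : opnorm (phi x) = rnorm x.
  by rewrite -rnorm_Bop /rnorm iphi.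
have phiD x y : phi (x + y) = phi x + phi y.
  by have := lphi 1 x y; rewrite !scale1r.
have phi0 : phi 0 = 0 by apply: (addrI (phi 0)); rewrite -phiD !addr0.
have phiZ a x : phi (a *: x) = a *: phi x.
  by have := lphi a x 0; rewrite phi0 !addr0.
have mE x y z : phi (amul x y) z = phi x (phi y z) by rewrite mphi.
have : opnorm (phi e - omega *: phi u) < 2.
  apply: (@cube_relation_opnorm_lt2 _ _ _ _ _ _ _ (phi (amul u u))).
  - by move=> x; rewrite -mE ee.
  - by move=> x; rewrite -mE eu.
  - by move=> x; rewrite -mE ue.
  - by move=> x; rewrite -mE.
  - by move=> x; rewrite -!Bop_scaleE -!Bop_addE -!phiZ -!phiD rel phi0.
  - by rewrite nphi.
  - by rewrite nphi.
  - rewrite nphi; have := ler_norm_amul u u.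
    rewrite !rnormE -rmorphM/= lecR => h; apply: le_trans h _.
    by rewrite mulr_ile1 ?rnorm_ge0.
rewrite -scaleNr -phiZ -phiD nphi scaleNr => /lt_le_trans/(_ n2).
by rewrite ltxx.
Qed.

End Obstruction.

Section QuotientObstruction.
Context (R : realType) (A : normedAlgType R[i]) (J : closedIdeal A).

Lemma pi_quotAlg_eq0 (x : A) : J x -> pi_quotAlg J x = 0.
Proof. by move=> Jx; rewrite -(linear0 (pi_quotAlg J)); apply/pi_quotmodP; rewrite subr0. Qed.

Lemma pi_quotAlg_mem (x y : A) : pi_quotAlg J x = pi_quotAlg J y -> J (x - y).
Proof. by move=> xy; apply/pi_quotmodP. Qed.

Lemma quotAlg_amulE (x y : A) :
  amul (pi_quotAlg J x : quotAlg J) (pi_quotAlg J y) = pi_quotAlg J (amul x y).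
Proof. by rewrite pi_quotAlgM. Qed.

(** The same obstruction read off in the algebra A above the quotient: a
    quotient norm is an infimum over the lifts of an element. *)
Lemma cube_quotient_not_acts_on_Lp (e u : A) :
  amul e e = e -> amul e u = u -> amul u e = u -> rnorm e <= 1 -> rnorm u <= 1 ->
  J (e + omega *: u + (omega * omega) *: amul u u) ->
  (forall x, J (x - (e - omega *: u)) -> 2 <= rnorm x) ->
  forall (p : R) (p1 : 1 <= p), ~ acts_on_Lp (quotAlg J) p p1.
Proof.
move=> ee eu ue e1 u1 rel far p p1.
apply: (@cube_relation_not_acts R (quotAlg J) (pi_quotAlg J e) (pi_quotAlg J u)).
- by rewrite quotAlg_amulE ee.
- by rewrite quotAlg_amulE eu.
- by rewrite quotAlg_amulE ue.
- exact: le_trans (quotAlg_norm_le _ _) e1.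
- exact: le_trans (quotAlg_norm_le _ _) u1.
- have := pi_quotAlg_eq0 rel.
  by rewrite quotAlg_amulE !linearD !linearZ.
rewrite rnorm_quotAlg -[leRHS]mul1r; apply: le_quotAlg_norm => // x xq.
rewrite mul1r; apply: far; apply: pi_quotAlg_mem.
by rewrite linearB linearZ; exact: xq.
Qed.

End QuotientObstruction.

(** * Coefficients and weighted sums in l^1(Z) *)

Section IntCounting.
Context (R : realType).

Lemma counting_int_set1 (n : int) : counting_int R [set n] = 1%:E.
Proof. by rewrite /counting_int/= /counting asboolT// fset_set1 finmap.cardfs1. Qed.

Lemma counting_int_ae (P : int -> Prop) :
  {ae counting_int R, forall n, P n} -> forall n, P n.
Proof.
move=> [N [mN N0 PN]] n; apply: contrapT => nP; have Nn : N n by exact: PN.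
have : (counting_int R [set n] <= counting_int R N)%E.
  by apply: le_measure; rewrite ?inE// => m ->.
by rewrite counting_int_set1 N0 lee_fin ler10.
Qed.

Lemma cmeasurable_int (f : int -> R[i]) : cmeasurable f.
Proof. by []. Qed.

Lemma Rintegral_int_support1 (f : int -> R) : (forall n, n != 0 -> f n = 0) ->
  Rintegral (counting_int R) [set: int] f = f 0.
Proof.
move=> f0; rewrite /Rintegral.
have -> : (fun n => (f n)%:E) = (EFin \o f) \_ [set 0].
  apply/funext => n; rewrite /patch; case: ifPn => //.
  by rewrite notin_setE => n0; rewrite f0//; apply/eqP.
rewrite -integral_mkcond.
rewrite (eq_integral (cst (f 0)%:E)); last by move=> n; rewrite inE => /= ->.
by rewrite integral_cst// counting_int_set1 mule1.
Qed.

Lemma Rintegral_int_shift (g : int -> R) :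
  (counting_int R).-integrable [set: int] (EFin \o (fun n => g (n - 1))) ->
  Rintegral (counting_int R) [set: int] (fun n => g (n - 1)) =
  Rintegral (counting_int R) [set: int] g.
Proof.
pose prev (n : int) := n - 1; move=> ig.
have mprev : measurable_fun [set: int] prev by [].
rewrite /Rintegral; congr fine.
have -> : (\int[counting_int R]_n (g n)%:E =
    \int[pushforward (counting_int R) prev]_n (g n)%:E)%E.
  apply: eq_measure_integral => X mX _; apply/esym/counting_preimage.
    by move=> n; exact: subrK.
  by move=> n; exact: addrK.
by rewrite integral_pushforward.
Qed.

End IntCounting.

Section Coefficients.
Context (R : realType).
Local Notation F := (LpFun (counting_int R) (lexx (1 : R))).
Local Notation E := (l1Z R).
Implicit Types (x y : E) (f : F).

(** The counting measure has no null set other than the empty one, so a class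
    in l^1(Z) has well-defined values. *)
Definition coef x (n : int) : R[i] := (repr (x : Lp (counting_int R) (lexx (1 : R))) : F) n.

Lemma coefE f n : coef (pi_Lp f) n = f n.
Proof.
have /pi_LpP/counting_int_ae : pi_Lp (repr (pi_Lp f)) = pi_Lp f.
  exact: repr_quotmodK.
by move=> /(_ n) /(_ I).
Qed.

Lemma coefD x y n : coef (x + y) n = coef x n + coef y n.
Proof.
have [f <-] := pi_Lp_surj x; have [g <-] := pi_Lp_surj y.
by rewrite -linearD !coefE.
Qed.

Lemma coefZ a x n : coef (a *: x) n = a * coef x n.
Proof.
have [f <-] := pi_Lp_surj x.
by rewrite -linearZ !coefE.
Qed.

Lemma coef_shift x n : coef (bilateral_shift R x) n = coef x (n - 1).
Proof.
have [f <-] := pi_Lp_surj x.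
by rewrite bilateral_shiftE !coefE.
Qed.

Lemma coef_integrable x : (counting_int R).-integrable [set: int]
  (EFin \o (fun n => Normc.normc (coef x n))).
Proof. exact: (L1_integrable (repr (x : Lp (counting_int R) (lexx (1 : R))) : F)). Qed.

Lemma rnorm_coef x : rnorm x =
  Rintegral (counting_int R) [set: int] (fun n => Normc.normc (coef x n)).
Proof.
have [f <-] := pi_Lp_surj x; rewrite [LHS](L1_norm f).
by apply: eq_Rintegral => n _; rewrite coefE.
Qed.

Lemma rnorm_shift x : rnorm (bilateral_shift R x) = rnorm x.
Proof.
rewrite !rnorm_coef -[RHS]Rintegral_int_shift.
  by apply: eq_Rintegral => n _; rewrite coef_shift.
have := coef_integrable (bilateral_shift R x); congr (integrable _ _ _).
by apply/funext => n /=; rewrite coef_shift.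
Qed.

Definition bounded_weight (c : int -> R[i]) :=
  exists M : R, forall n, Normc.normc (c n) <= M.

(** The real part of the sum of c n * x n. It determines the complex
    functional, since multiplying c by - i turns real parts into imaginary
    ones, and it only involves integrals of real functions. *)
Definition pairing (c : int -> R[i]) x : R :=
  Rintegral (counting_int R) [set: int] (fun n => complex.Re (c n * coef x n)).

Lemma pairing_integrable c x : bounded_weight c ->
  (counting_int R).-integrable [set: int]
    (EFin \o (fun n => complex.Re (c n * coef x n))).
Proof.
move=> [M cM]; apply: (le_integrable measurableT _ _
    (integrableZl measurableT M (coef_integrable x))) => //.
move=> n _ /=; rewrite lee_fin normrM (ger0_norm (normc_ge0 _)).
apply: le_trans (normc_Re_Im _).1 _; rewrite Normc.normcM ler_wpM2r ?normc_ge0//.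
exact: le_trans (ler_norm _).
Qed.

Lemma pairing_le c x M : (forall n, Normc.normc (c n) <= M) ->
  `|pairing c x| <= M * rnorm x.
Proof.
move=> cM; have bc : bounded_weight c by exists M.
have ii := pairing_integrable x bc.
apply: le_trans (le_normr_Rintegral measurableT ii) _.
rewrite rnorm_coef -RintegralZl//; last exact: coef_integrable.
apply: le_Rintegral => //.
- have := integrable_abse ii; by [].
- by have := integrableZl measurableT M (coef_integrable x).
move=> n _; apply: le_trans (normc_Re_Im _).1 _.
by rewrite Normc.normcM ler_wpM2r ?normc_ge0.
Qed.

Lemma pairingD c x y : bounded_weight c ->
  pairing c (x + y) = pairing c x + pairing c y.
Proof.
move=> bc; rewrite /pairing -RintegralD//; try exact: pairing_integrable.
by apply: eq_Rintegral => n _; rewrite coefD mulrDr raddfD.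
Qed.

Lemma pairingDl b c x : bounded_weight b -> bounded_weight c ->
  pairing (fun n => b n + c n) x = pairing b x + pairing c x.
Proof.
move=> bb bc; rewrite /pairing -RintegralD//; try exact: pairing_integrable.
by apply: eq_Rintegral => n _; rewrite mulrDl raddfD.
Qed.

Lemma pairingZ c a x : pairing c (a *: x) = pairing (fun n => a * c n) x.
Proof. by apply: eq_Rintegral => n _; rewrite coefZ mulrCA mulrA. Qed.

Lemma pairing_shift c x : bounded_weight c ->
  pairing c (bilateral_shift R x) = pairing (fun n => c (n + 1)) x.
Proof.
move=> bc; rewrite /pairing -[RHS]Rintegral_int_shift.
  by apply: eq_Rintegral => n _; rewrite coef_shift subrK.
have := pairing_integrable (bilateral_shift R x) bc.
congr (integrable _ _ _).
by apply/funext => n /=; rewrite coef_shift subrK.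
Qed.

Lemma pairing_inverse_shift c x : bounded_weight c ->
  pairing c (inverse_bilateral_shift R x) = pairing (fun n => c (n - 1)) x.
Proof.
move=> [M cM].
have bc' : bounded_weight (fun n => c (n - 1)) by exists M.
rewrite -[in RHS](inverse_bilateral_shiftK x) pairing_shift//.
by apply: eq_Rintegral => n _; rewrite addrK.
Qed.

End Coefficients.

(** * The ideal of F^1(Z) cut out by the spectrum {1, omega} *)

Lemma closed_zero_set (R : realType) (V : normedModType R[i]) (L : V -> R) (M : R) :
  (forall x y, L (x + y) = L x + L y) -> (forall x, `|L x| <= M * rnorm x) ->
  closed [set x | L x = 0].
Proof.
move=> LD LM x clx; apply/eqP; rewrite -normr_le0; apply/ler_addgt0Pl => r r0.
rewrite addr0.
have M0 : 0 < `|M| + 1 by rewrite ltr_wpDl.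
have e0 : 0 < (r / (`|M| + 1))%:C by rewrite ltcR divr_gt0.
have [y [Ly xy]] := clx _ (nbhsx_ballx x _ e0).
have {}Ly : L y = 0 by exact: Ly.
have L0 : L 0 = 0 by apply: (addrI (L 0)); rewrite -LD !addr0.
have Lxy : L x = L (x - y).
  by rewrite -[in LHS](subrK y x) (LD (x - y) y) Ly addr0.
rewrite Lxy; apply: le_trans (LM _) _.
move: xy; rewrite -ball_normE/= rnormE ltcR => xy.
apply: (@le_trans _ _ ((`|M| + 1) * rnorm (x - y))).
  by rewrite ler_wpM2r ?rnorm_ge0// (le_trans (ler_norm M))// lerDl.
by rewrite mulrC -ler_pdivlMr// ltW.
Qed.

Section SubAlgebraVal.
Context (K : numFieldType) (A : normedAlgType K) (B : closedSubalgebra A).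
Implicit Types U V : subAlg B.

Lemma val_subAlgD U V : val (U + V) = val U + val V.
Proof. by []. Qed.

Lemma val_subAlgZ a U : val (a *: U) = a *: val U.
Proof. by []. Qed.

Lemma val_subAlg0 : val (0 : subAlg B) = 0.
Proof. by []. Qed.

Lemma val_subAlgM U V : val (amul U V) = amul (val U) (val V).
Proof. by []. Qed.

Lemma val_subAlgP U V : val U = val V -> U = V.
Proof. exact: val_inj. Qed.

End SubAlgebraVal.

Section SubAlgebraOperators.
Context (R : realType) (E : normedModType R[i]) (B : closedSubalgebra (Bop E)).
Implicit Types U V : subAlg B.

Definition op U : E -> E := val U : Bop E.

Lemma opD U V x : op (U + V) x = op U x + op V x.
Proof. by rewrite /op val_subAlgD Bop_addE. Qed.

Lemma opZ a U x : op (a *: U) x = a *: op U x.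
Proof. by rewrite /op val_subAlgZ Bop_scaleE. Qed.

Lemma opB U V x : op (U - V) x = op U x - op V x.
Proof. by rewrite opD -scaleN1r opZ scaleN1r. Qed.

Lemma op0 x : op 0 x = 0.
Proof. by rewrite /op val_subAlg0. Qed.

Lemma opM U V x : op (amul U V) x = op U (op V x).
Proof. by []. Qed.

Lemma rnorm_op U x : rnorm (op U x) <= rnorm x * rnorm U.
Proof. by rewrite mulrC; exact: (ler_opnorm (val U : Bop E)). Qed.

End SubAlgebraOperators.

Section CubeIdeal.
Context (R : realType).
Local Notation E := (l1Z R).
Local Notation A := (F1Z R).

(** The bounded solutions of this recurrence are spanned by the constant
    sequence and n |-> omega^n: they are the functionals on l^1(Z) that vanish
    on the range of 1 + omega s + omega^2 s^2, where s is the shift. *)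
Definition cube_weight (c : int -> R[i]) : Prop := bounded_weight c /\
  forall n, c n + omega * c (n + 1) + omega * omega * c (n + 2) = 0.

(** The vectors with Fourier transform zero at 1 and omega. *)
Definition annihilated (x : E) : Prop := forall c, cube_weight c -> pairing c x = 0.

Lemma cube_weightZ a c : cube_weight c -> cube_weight (fun n => a * c n).
Proof.
move=> [[M cM] rc]; split.
  by exists (Normc.normc a * M) => n; rewrite Normc.normcM ler_wpM2l ?normc_ge0.
by move=> n; rewrite -(mulr0 a) -(rc n); ring.
Qed.

Lemma cube_weight_next c : cube_weight c -> cube_weight (fun n => c (n + 1)).
Proof.
move=> [[M cM] rc]; split; first by exists M.
by move=> n; rewrite -(rc (n + 1)) (addrAC n 2 1).
Qed.

Lemma cube_weight_prev c : cube_weight c -> cube_weight (fun n => c (n - 1)).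
Proof.
move=> [[M cM] rc]; split; first by exists M.
by move=> n; rewrite -(rc (n - 1)) (addrAC n 2) (addrAC n 1).
Qed.

Lemma annihilatedD x y : annihilated x -> annihilated y -> annihilated (x + y).
Proof. by move=> hx hy c wc; rewrite pairingD ?hx ?hy ?addr0//; case: wc. Qed.

Lemma annihilatedZ a x : annihilated x -> annihilated (a *: x).
Proof. by move=> hx c wc; rewrite pairingZ hx//; exact: cube_weightZ. Qed.

Lemma annihilated0 : annihilated 0.
Proof.
move=> c [bc _]; have := pairingD 0 0 bc; rewrite addr0 => /eqP.
by rewrite -subr_eq subrr eq_sym => /eqP.
Qed.

Lemma pairing_val_closed (V : normedModType R[i]) (ev : V -> E) (N : R) c :
  (forall x y, ev (x + y) = ev x + ev y) -> (forall x, rnorm (ev x) <= N * rnorm x) ->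
  0 <= N -> bounded_weight c -> closed [set T | pairing c (ev T) = 0].
Proof.
move=> evD evN N0 [M cM].
apply: (@closed_zero_set _ _ (fun T => pairing c (ev T)) (M * N)).
  by move=> x y; rewrite evD pairingD//; exists M.
move=> x; apply: le_trans (pairing_le _ cM) _; rewrite -mulrA ler_wpM2l//.
exact: le_trans (normc_ge0 _) (cM 0).
Qed.

Lemma annihilated_eval_closed (V : normedModType R[i]) (ev : V -> E) (N : R) :
  (forall x y, ev (x + y) = ev x + ev y) -> (forall x, rnorm (ev x) <= N * rnorm x) ->
  0 <= N -> closed [set T | annihilated (ev T)].
Proof.
move=> evD evN N0.
have -> : [set T | annihilated (ev T)] =
    \bigcap_(c in [set c | cube_weight c]) [set T | pairing c (ev T) = 0].
  by apply/seteqP; split=> T h c wc; exact: h.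
by apply: closed_bigI => c [bc _]; exact: pairing_val_closed evD evN N0 bc.
Qed.

(** A closed algebra that contains both shifts, hence F^1(Z). It provides the
    left ideal property of [cube_ideal] without the commutativity of F^1(Z).
    *)
Definition stabilizer : set (Bop E) :=
  [set U | forall x, annihilated x -> annihilated (U x)].

Let stabilizer0 : stabilizer 0.
Proof. by move=> x _; exact: annihilated0. Qed.

Let stabilizerD U V : stabilizer U -> stabilizer V -> stabilizer (U + V).
Proof.
by move=> hU hV x hx; rewrite Bop_addE; apply: annihilatedD; [exact: hU|exact: hV].
Qed.

Let stabilizerZ a U : stabilizer U -> stabilizer (a *: U).
Proof. by move=> hU x hx; rewrite Bop_scaleE; apply: annihilatedZ; exact: hU. Qed.

Definition stabilizer_submodule : submodule (Bop E) :=
  Submodule stabilizer0 stabilizerD stabilizerZ.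

Let stabilizer_closed : closed (stabilizer_submodule : set (Bop E)).
Proof.
have -> : (stabilizer_submodule : set (Bop E)) =
    \bigcap_(x in annihilated) [set U : Bop E | annihilated (U x)].
  by apply/seteqP; split=> U h x hx; exact: h.
apply: closed_bigI => x _.
apply: (@annihilated_eval_closed _ (fun U : Bop E => U x) (rnorm x)).
- by move=> U V; exact: Bop_addE.
- by move=> U; rewrite mulrC; exact: ler_opnorm.
- exact: rnorm_ge0.
Qed.

Let stabilizerM U V : stabilizer U -> stabilizer V -> stabilizer (amul U V).
Proof. by move=> hU hV x hx; apply: hU; exact: hV. Qed.

Definition stabilizer_subalgebra : closedSubalgebra (Bop E) :=
  ClosedSubalgebra stabilizer_closed stabilizerM.

Lemma F1Z_stabilizer (U : A) x : annihilated x -> annihilated (op U x).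
Proof.
move: x; rewrite -/(stabilizer (val U)).
have := submodP U; move/(_ stabilizer_subalgebra); apply.
move=> _ [->|->] x hx c wc.
  rewrite pairing_shift; last by case: wc.
  by apply: hx; exact: cube_weight_next.
rewrite pairing_inverse_shift; last by case: wc.
by apply: hx; exact: cube_weight_prev.
Qed.

(** The operators of F^1(Z) whose symbol vanishes at 1 and omega. *)
Definition cube_ideal_set : set A := [set U | forall x, annihilated (op U x)].

Let cube_ideal0 : cube_ideal_set 0.
Proof. by move=> x; rewrite op0; exact: annihilated0. Qed.

Let cube_idealD U V : cube_ideal_set U -> cube_ideal_set V -> cube_ideal_set (U + V).
Proof. by move=> hU hV x; rewrite opD; exact: annihilatedD (hU x) (hV x). Qed.

Let cube_idealZ a U : cube_ideal_set U -> cube_ideal_set (a *: U).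
Proof. by move=> hU x; rewrite opZ; exact: annihilatedZ (hU x). Qed.

Definition cube_ideal_submodule : submodule A :=
  Submodule cube_ideal0 cube_idealD cube_idealZ.

Let cube_ideal_closed : closed (cube_ideal_submodule : set A).
Proof.
have -> : (cube_ideal_submodule : set A) =
    \bigcap_(x in [set: E]) [set U : A | annihilated (op U x)].
  by apply/seteqP; split=> U h x => [_|]; exact: h.
apply: closed_bigI => x _.
apply: (@annihilated_eval_closed _ (fun U : A => op U x) (rnorm x)).
- by move=> U V; exact: opD.
- by move=> U; exact: rnorm_op.
- exact: rnorm_ge0.
Qed.

Let cube_idealMl U V : cube_ideal_submodule V -> cube_ideal_submodule (amul U V).
Proof. by move=> hV x; rewrite opM; apply: F1Z_stabilizer; exact: hV. Qed.

Let cube_idealMr U V : cube_ideal_submodule U -> cube_ideal_submodule (amul U V).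
Proof. by move=> hU x; rewrite opM; exact: hU. Qed.

Definition cube_ideal : closedIdeal A :=
  ClosedIdeal cube_ideal_closed cube_idealMl cube_idealMr.

End CubeIdeal.

Section CubeQuotient.
Context (R : realType).
Local Notation E := (l1Z R).
Local Notation A := (F1Z R).

(** The functional 1 |-> 1, s |-> - omega^2, s^2 |-> 0 on the quotient,
    extended by s^3 = 1. It comes from the equilateral triangle with a vertex
    at the origin and two vertices on the unit circle, and it has norm 1 on
    l^1(Z) because all its values are in the unit disc. *)
Definition cube_functional (n : int) : R[i] :=
  if (n %% 3)%Z == 0 then 1 else if (n %% 3)%Z == 1 then - (omega * omega) else 0.

Lemma normc_cube_functional n : Normc.normc (cube_functional n) <= 1.
Proof.
rewrite /cube_functional; case: ifP => _; first by rewrite Normc.normc1.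
case: ifP => _; last by rewrite Normc.normc0 ler01.
by rewrite normcN Normc.normcM normc_omega mul1r.
Qed.

Lemma cube_weight_functional : cube_weight cube_functional.
Proof.
split; first by exists 1; exact: normc_cube_functional.
move=> n; rewrite /cube_functional -(modzDml n 1) -(modzDml n 2).
have := modz_ge0 n (isT : (3 : int) != 0); have := ltz_mod n (isT : (3 : int) != 0).
move: (n %% 3)%Z => [[|[|[|r]]]|r] //= _ _.
- rewrite mulr0 addr0 mulrN mulrA omega_cube subrr //.
- by rewrite mulr0 addr0 mulr1 addNr.
- by rewrite add0r mulr1 mulrN mulrA omega_cube mul1r subrr.
Qed.

Definition delta0_fun (n : int) : R[i] := if n == 0 then 1 else 0.

Lemma normc_delta0_fun n : Normc.normc (delta0_fun n) = if n == 0 then 1 else 0.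
Proof.
by rewrite /delta0_fun; case: ifP; rewrite ?Normc.normc1 ?Normc.normc0.
Qed.

Lemma delta0_cLnorm : (cLnorm (counting_int R) 1 delta0_fun < +oo)%E.
Proof.
rewrite cLnormE; apply: poweR_lty.
have -> : (fun n => (`|Normc.normc (delta0_fun n)| `^ 1)%:E) =
    (cst 1%:E) \_ [set 0 : int].
  apply/funext => n; rewrite normc_delta0_fun /patch.
  have [->|n0] := eqVneq n 0; first by rewrite mem_set// normr1 powR1.
  by rewrite memNset ?normr0 ?powR0 ?oner_eq0//; exact/eqP.
rewrite -integral_mkcond integral_cst// counting_int_set1 mule1; exact: ltry.
Qed.

Definition delta0 : E :=
  pi_Lp (to_LpFun (lexx (1 : R)) (@cmeasurable_int R delta0_fun) delta0_cLnorm).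

Lemma coef_delta0 n : coef delta0 n = if n == 0 then 1 else 0.
Proof. exact: coefE. Qed.

Lemma rnorm_delta0 : rnorm delta0 = 1.
Proof.
rewrite rnorm_coef Rintegral_int_support1 ?coef_delta0 ?Normc.normc1// => n n0.
by rewrite coef_delta0 (negbTE n0) Normc.normc0.
Qed.

Lemma pairing_delta0 c : pairing c delta0 = complex.Re (c 0).
Proof.
rewrite /pairing Rintegral_int_support1 ?coef_delta0 ?mulr1// => n n0.
by rewrite coef_delta0 (negbTE n0) mulr0.
Qed.

Let generators := [set bilateral_shift R; inverse_bilateral_shift R].

Definition F1Z_shift : A :=
  @to_submod _ _ (generated_subalgebra generators) (bilateral_shift R)
    (sub_generated_set (or_introl erefl)).

Definition F1Z_inverse_shift : A :=
  @to_submod _ _ (generated_subalgebra generators) (inverse_bilateral_shift R)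
    (sub_generated_set (or_intror erefl)).

Definition F1Z_one : A := amul F1Z_shift F1Z_inverse_shift.

Lemma op_shift x : op F1Z_shift x = bilateral_shift R x.
Proof. by []. Qed.

Lemma op_one x : op F1Z_one x = x.
Proof. by rewrite opM; exact: inverse_bilateral_shiftK. Qed.

Lemma opP (U V : A) : op U =1 op V -> U = V.
Proof. by move=> UV; apply: val_subAlgP; apply: BopP => x; exact: UV. Qed.

Lemma F1Z_mul1r U : amul F1Z_one U = U.
Proof. by apply: opP => x; rewrite opM op_one. Qed.

Lemma F1Z_mulr1 U : amul U F1Z_one = U.
Proof. by apply: opP => x; rewrite opM op_one. Qed.

Lemma rnorm_F1Z_le (U : A) M : 0 <= M -> (forall x, rnorm (op U x) <= M * rnorm x) ->
  rnorm U <= M.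
Proof. exact: (@opnorm_le _ _ (val U : Bop E)). Qed.

Lemma rnorm_F1Z_one : rnorm F1Z_one <= 1.
Proof. by apply: rnorm_F1Z_le => // x; rewrite op_one mul1r. Qed.

Lemma rnorm_F1Z_shift : rnorm F1Z_shift <= 1.
Proof.
by apply: rnorm_F1Z_le => // x; rewrite op_shift mul1r rnorm_shift.
Qed.

Let weightZ (a : R[i]) b : bounded_weight b -> bounded_weight (fun n => a * b n).
Proof.
move=> [M bM]; exists (Normc.normc a * M) => n.
by rewrite Normc.normcM ler_wpM2l ?normc_ge0.
Qed.

Let weightS (b : int -> R[i]) : bounded_weight b -> bounded_weight (fun n => b (n + 1)).
Proof. by move=> [M bM]; exists M. Qed.

Let weightD (b c : int -> R[i]) : bounded_weight b -> bounded_weight c ->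
  bounded_weight (fun n => b n + c n).
Proof.
move=> [M bM] [N cN]; exists (M + N) => n.
exact: le_trans (le_normcD _ _) (lerD (bM n) (cN n)).
Qed.

Lemma cube_relation_annihilated (x : E) : annihilated (x + omega *: bilateral_shift R x
  + (omega * omega) *: bilateral_shift R (bilateral_shift R x)).
Proof.
move=> c [bc rc].
have z1 := weightZ omega bc; have z2 := weightZ (omega * omega) bc.
have w1 := weightS z1; have w2 := weightS z2; have w3 := weightS w2.
have w01 := weightD bc w1.
rewrite !pairingD// !pairingZ !pairing_shift// -!pairingDl//.
have -> : pairing (fun n => c n + omega * c (n + 1) + omega * omega * c (n + 1 + 1)) x
    = pairing (fun=> 0) x.
  congr (pairing _ x); apply/funext => n.
  by rewrite -(addrA n 1 1) -(rc n).
by rewrite /pairing Rintegral_int_support1 => [|n _]; rewrite mul0r.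
Qed.

Lemma op_cube_relation x :
  op (F1Z_one + omega *: F1Z_shift + (omega * omega) *: amul F1Z_shift F1Z_shift) x =
  x + omega *: bilateral_shift R x
  + (omega * omega) *: bilateral_shift R (bilateral_shift R x).
Proof. by rewrite !opD !opZ op_one opM !op_shift. Qed.

Lemma cube_relation_mem : cube_ideal R
  (F1Z_one + omega *: F1Z_shift + (omega * omega) *: amul F1Z_shift F1Z_shift).
Proof.
by move=> x; rewrite op_cube_relation; exact: cube_relation_annihilated.
Qed.

Lemma op_one_sub_shift x : op (F1Z_one - omega *: F1Z_shift) x =
  x + (- omega) *: bilateral_shift R x.
Proof. by rewrite opB opZ op_one op_shift scaleNr. Qed.

Lemma pairing_cube_functional :
  pairing cube_functional (delta0 + (- omega) *: bilateral_shift R delta0) = 2.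
Proof.
have [bc _] := cube_weight_functional.
rewrite pairingD// pairingZ pairing_shift; last exact: weightZ.
rewrite !pairing_delta0 /cube_functional add0r.
rewrite [(0 %% 3)%Z]/= [(1 %% 3)%Z]/= mulrNN mulrA omega_cube.
by rewrite /=; lra.
Qed.

(** The functional takes the value 2 at the image of the unit vector under 1 -
    omega s, and vanishes on its image under an element of the ideal. *)
Lemma cube_functional_far (U : A) :
  cube_ideal R (U - (F1Z_one - omega *: F1Z_shift)) -> 2 <= rnorm U.
Proof.
move=> /(_ delta0 _ cube_weight_functional) h.
have bc : bounded_weight cube_functional by case: cube_weight_functional.
have hU : pairing cube_functional (op U delta0) = 2.
  rewrite -pairing_cube_functional -op_one_sub_shift -[LHS]subr0.
  have -> : op U delta0 = op (U - (F1Z_one - omega *: F1Z_shift)) delta0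
      + op (F1Z_one - omega *: F1Z_shift) delta0 by rewrite opB subrK.
  by rewrite pairingD// h add0r subr0.
rewrite -hU; apply: le_trans (ler_norm _) _.
apply: le_trans (pairing_le _ normc_cube_functional) _.
rewrite mul1r (le_trans (rnorm_op _ _))//.
by rewrite rnorm_delta0 mul1r.
Qed.

Lemma cube_quotient_not_acts (p : R) (p1 : 1 <= p) :
  ~ acts_on_Lp (quotAlg (cube_ideal R)) p p1.
Proof.
apply: (@cube_quotient_not_acts_on_Lp R A (cube_ideal R) F1Z_one F1Z_shift).
- exact: F1Z_mul1r.
- exact: F1Z_mul1r.
- exact: F1Z_mulr1.
- exact: rnorm_F1Z_one.
- exact: rnorm_F1Z_shift.
- exact: cube_relation_mem.
- exact: cube_functional_far.
Qed.

End CubeQuotient.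

(** * Completeness of F^1(Z) *)

Section RealCauchy.
Context (R : realType).

Definition rcauchy (V : normedModType R[i]) (G : set_system V) := forall e : R, 0 < e ->
  exists2 P, G P & forall x y, P x -> P y -> rnorm (x - y) <= e.

(** Completeness with real radii: the balls of a normed module over R[i] have
    radii in R[i]. *)
Definition rcomplete (V : normedModType R[i]) := forall G : set_system V,
  ProperFilter G -> rcauchy G ->
  exists l, forall e : R, 0 < e -> G [set x | rnorm (l - x) <= e].

Lemma cauchy_rcauchy (V : normedModType R[i]) (G : set_system V) :
  ProperFilter G -> cauchy G -> rcauchy G.
Proof.
move=> GF /cauchyP cG e e0.
have e20 : 0 < (e / 2)%:C by rewrite ltcR divr_gt0.
have [x Gx] := cG _ e20; exists (ball x (e / 2)%:C) => // y z.
rewrite -ball_normE/= !rnormE !ltcR => xy xz.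
have -> : y - z = (x - z) - (x - y) by rewrite opprB [RHS]addrC addrA subrK.
apply: le_trans (rnormD _ _) _; rewrite rnormN; lra.
Qed.

Lemma rcomplete_cauchy_cvg (V : normedModType R[i]) : rcomplete V ->
  forall G : set_system V, ProperFilter G -> cauchy G -> cvg G.
Proof.
move=> cV G GF /cauchy_rcauchy/(cV G GF)[l Gl]; apply/cvg_ex; exists l.
apply/(@cvgrPdist_le _ _ _ G _ id) => e e0.
have eR : e = (complex.Re e)%:C by rewrite RRe_real// gtr0_real.
have e0R : 0 < complex.Re e by rewrite -ltcR -eR.
by apply: filterS (Gl _ e0R) => x /= lx; rewrite rnormE eR lecR.
Qed.

(** The functional maps a Cauchy filter to a Cauchy filter of R, which is
    complete. *)
Lemma rcauchy_functional (V : normedModType R[i]) (L : V -> R) (M : R)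
    (G : set_system V) : ProperFilter G -> rcauchy G ->
  (forall x y, L (x - y) = L x - L y) -> (forall x, `|L x| <= M * rnorm x) ->
  exists l : R, forall e : R, 0 < e -> G [set x | `|L x - l| <= e].
Proof.
move=> GF cG LB LM.
have M0 : 0 < `|M| + 1 by rewrite ltr_wpDl.
have /cauchy_cvg : cauchy (L @ G).
  apply/cauchy_exP => e e0.
  have [|P GP Pd] := cG (e / 2 / (`|M| + 1)); first by rewrite !divr_gt0.
  have [x Px] := filter_ex GP; exists (L x).
  suff : G (L @^-1` ball (L x) e) by [].
  apply: filterS GP => y Py.
  suff : `|L x - L y| < e by [].
  rewrite -LB; apply: le_lt_trans (LM _) _.
  apply: (@le_lt_trans _ _ ((`|M| + 1) * rnorm (x - y))).
    by rewrite ler_wpM2r ?rnorm_ge0// (le_trans (ler_norm M))// lerDl.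
  rewrite mulrC -ltr_pdivlMr//; apply: le_lt_trans (Pd _ _ Px Py) _.
  by rewrite ltr_pM2r ?invr_gt0//; lra.
move=> /cvg_ex[l /= Gl]; exists l => e e0.
have /cvgrPdist_le/(_ e e0) := Gl.
by apply: filterS => x /=; rewrite distrC.
Qed.

Lemma rcauchy_image (V W : normedModType R[i]) (f : V -> W) (M : R)
    (G : set_system V) : ProperFilter G -> rcauchy G ->
  (forall x y, rnorm (f x - f y) <= M * rnorm (x - y)) -> rcauchy (f @ G).
Proof.
move=> GF cG fM e e0.
have M0 : 0 < `|M| + 1 by rewrite ltr_wpDl.
have [|P GP Pd] := cG (e / (`|M| + 1)); first by rewrite divr_gt0.
exists (f @` P).
  suff : G (f @^-1` (f @` P)) by [].
  by apply: filterS GP => x Px; exists x.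
move=> _ _ [x Px <-] [y Py <-]; apply: le_trans (fM _ _) _.
apply: (@le_trans _ _ ((`|M| + 1) * rnorm (x - y))).
  by rewrite ler_wpM2r ?rnorm_ge0// (le_trans (ler_norm M))// lerDl.
by rewrite mulrC -ler_pdivlMr// Pd.
Qed.

Lemma rnorm_eq0_small (V : normedModType R[i]) (x : V) :
  (forall e : R, 0 < e -> rnorm x <= e) -> x = 0.
Proof.
move=> xe; apply: rnorm0_eq0; apply/le_anti; rewrite rnorm_ge0 andbT.
by apply/ler_addgt0Pl => e e0; rewrite addr0 xe.
Qed.

(** The limit is taken pointwise; it is bounded, and a limit in norm, because
    a bound on the diameter of a set of operators passes to pointwise limits.
    *)
Lemma Bop_rcomplete (E : normedModType R[i]) : rcomplete E -> rcomplete (Bop E).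
Proof.
move=> cE G GF cG.
have BopB (T U : Bop E) x : (T - U : Bop E) x = T x - U x.
  by rewrite Bop_addE -scaleN1r Bop_scaleE scaleN1r.
have lim x : exists l, forall e : R, 0 < e -> G [set T : Bop E | rnorm (l - T x) <= e].
  have c : rcauchy ((fun T : Bop E => T x) @ G).
    apply: (rcauchy_image (M := rnorm x) GF cG) => T U.
    by rewrite -BopB mulrC; exact: ler_opnorm.
  by have [l Gl] := cE _ _ c; exists l => e /Gl.
have [g Gg] := choice lim.
have lg : linear g.
  move=> a x y; apply/eqP; rewrite -subr_eq0; apply/eqP.
  apply: rnorm_eq0_small => e e0; pose k := Normc.normc a + 2.
  have k0 : 0 < k by rewrite ltr_wpDl ?normc_ge0.
  pose dl := e / k; have d0 : 0 < dl by rewrite divr_gt0.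
  have -> : e = k * dl by rewrite mulrC divfK ?gt_eqF.
  clearbody dl.
  have [T [[/= T1 T2] T3]] :=
    filter_ex (filterI (filterI (Gg (a *: x + y) _ d0) (Gg x _ d0)) (Gg y _ d0)).
  have -> : g (a *: x + y) - (a *: g x + g y) = (g (a *: x + y) - T (a *: x + y))
      - (a *: (g x - T x) + (g y - T y)).
    have -> : T (a *: x + y) = a *: T x + T y by rewrite linearD linearZ.
    rewrite scalerBr; move: (g _) (a *: g x) (g y) (a *: T x) (T y) => q r s t z.
    by rewrite [r - t + _]addrACA -opprD opprB addrA subrK.
  apply: le_trans (rnormD _ _) _; rewrite rnormN.
  apply: le_trans (lerD (lexx _) (rnormD _ _)) _; rewrite rnormZ.
  have := ler_wpM2l (normc_ge0 a) T2.
  by move: T1 T3; rewrite /k /=; lra.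
have close (P : set (Bop E)) (GP : G P) (r : R) :
    (forall T U : Bop E, P T -> P U -> rnorm (T - U) <= r) ->
    forall T : Bop E, P T -> forall x, rnorm (g x - T x) <= r * rnorm x.
  move=> Pr T PT x; apply/ler_addgt0Pl => e e0.
  have [U [/= U1 PU]] := filter_ex (filterI (Gg x _ e0) GP).
  have -> : g x - T x = (g x - U x) + (U x - T x) by rewrite addrA subrK.
  apply: le_trans (rnormD _ _) _; apply: lerD => //.
  rewrite -BopB; apply: le_trans (ler_opnorm _ _) _.
  by rewrite ler_wpM2r ?rnorm_ge0//; exact: Pr.
have bg : exists M : R, forall x, rnorm (g x) <= M * rnorm x.
  have [P GP Pd] := cG 1 ltr01; have [T0 PT] := filter_ex GP.
  pose T : Bop E := T0.
  exists (1 + opnorm T) => x; rewrite -[g x](subrK (T x)) mulrDl.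
  apply: le_trans (rnormD _ _) _; apply: lerD; last exact: ler_opnorm.
  exact: close GP _ Pd _ PT _.
exists (to_Bop lg bg) => e e0; have [P GP Pd] := cG e e0.
apply: filterS (GP) => T PT /=; apply: opnorm_le; first exact: ltW.
by move=> x; rewrite BopB; exact: (close _ GP _ Pd).
Qed.

Lemma subAlg_rcomplete (A : normedAlgType R[i]) (B : closedSubalgebra A) :
  rcomplete A -> rcomplete (subAlg B).
Proof.
move=> cA G GF cG.
have valB (x y : subAlg B) : val (x - y) = val x - val y.
  by rewrite val_subAlgD -(scaleN1r y) val_subAlgZ scaleN1r.
have c : rcauchy ((val : subAlg B -> A) @ G).
  by apply: (rcauchy_image (M := 1) GF cG) => x y; rewrite mul1r -valB.
have [l Gl] := cA _ _ c.
have Bl : B l.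
  apply: (@closedSubalgebra_closed _ _ B) => N /nbhs_ballP[e /= e0 eN].
  have eR : e = (complex.Re e)%:C by rewrite RRe_real// gtr0_real.
  have e0R : 0 < complex.Re e / 2 by rewrite divr_gt0// -ltcR -eR.
  have /filter_ex[x /= lx] : G [set x | rnorm (l - val x) <= complex.Re e / 2].
    exact: Gl.
  exists (val x); split; first exact: submodP.
  apply: eN; rewrite -ball_normE/= rnormE eR ltcR.
  apply: le_lt_trans lx _; lra.
exists (to_submod Bl) => e e0.
have : G [set x | rnorm (l - val x) <= e] by exact: Gl.
apply: filterS => x /= lx; apply: le_trans lx.
by have -> : l - val x = val (to_submod Bl - x : subAlg B) by rewrite valB.
Qed.

End RealCauchy.

Section L1ZComplete.
Context (R : realType).
Local Notation E := (l1Z R).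
Local Notation mu := (counting_int R).

(** Integrals over Z are suprema of integrals over windows, which are finite
    sums. *)
Definition window (n : nat) : set int := [set k | (absz k <= n)%N].

Lemma finite_window n : finite_set (window n).
Proof.
apply: (@sub_finite_set _ _ (Posz @` `I_n.+1 `|` Negz @` `I_n)).
  by move=> [k|k] /= kn; [left|right]; exists k.
by rewrite finite_setU; split; apply: finite_image; exact: finite_II.
Qed.

Lemma integral_le_window (g : int -> \bar R) (b : \bar R) :
  (forall k, 0 <= g k)%E -> (forall n, \int[mu]_(k in window n) g k <= b)%E ->
  (\int[mu]_k g k <= b)%E.
Proof.
move=> g0 gb.
have nd : nondecreasing_seq window.
  by move=> m n mn; apply/subsetPset => k /= km; exact: leq_trans mn.
have <- : \bigcup_n window n = [set: int].
  by apply/seteqP; split=> // k _; exists (absz k) => //; exact: leqnn.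
have := @ge0_nondecreasing_set_cvg_integral _ _ R window g mu nd
  (fun=> I) (fun _ _ _ _ => I) (fun _ _ _ => g0 _).
move=> cv; rewrite -(cvg_lim _ cv)//; apply: lime_le; last exact: nearW.
by apply/cvg_ex; exists (\int[mu]_(k in \bigcup_n window n) g k)%E.
Qed.

Lemma integral_window_cst n (b : R) :
  (\int[mu]_(k in window n) b%:E = (b * fine (mu (window n)))%:E)%E.
Proof.
rewrite integral_cst// EFinM fineK//.
by rewrite /counting_int/= /counting asboolT//; exact: finite_window.
Qed.

Lemma normc_coef_le (x : E) n : Normc.normc (coef x n) <= rnorm x.
Proof.
have := integrable_fin_num measurableT (coef_integrable x).
rewrite rnorm_coef -lee_fin => /fineK ->.
have <- : (\int[mu]_(k in [set n]) (Normc.normc (coef x k))%:E =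
    (Normc.normc (coef x n))%:E)%E.
  rewrite (eq_integral (cst (Normc.normc (coef x n))%:E)).
    by rewrite integral_cst// counting_int_set1 mule1.
  by move=> k; rewrite inE => /= ->.
apply: ge0_subset_integral => // k _; by rewrite lee_fin normc_ge0.
Qed.

Lemma rnorm_coefE (x : E) : ((rnorm x)%:E = \int[mu]_k (Normc.normc (coef x k))%:E)%E.
Proof.
by rewrite rnorm_coef fineK//; exact: integrable_fin_num (coef_integrable x).
Qed.

Lemma coefB (x y : E) n : coef (x - y) n = coef x n - coef y n.
Proof. by rewrite coefD -scaleN1r coefZ mulN1r. Qed.

(** The limit l is taken coefficientwise. If P is a member of the filter of
    diameter at most r, then on each window every x in P is within 2 r of l:
    compare x with a y in P that is close to l at the finitely many points of
    the window. *)
Lemma l1Z_rcomplete : rcomplete E.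
Proof.
move=> G GF cG.
have ReIm (z : R[i]) (a b : R) : `|complex.Re z - a| <= b -> forall c d : R,
    `|complex.Im z - c| <= d -> Normc.normc (z - (a +i* c)) <= b + d.
  move=> za c d zc; case: z za zc => u v /= za zc.
  have h1 := le_normcD ((u - a) +i* 0) (0 +i* (v - c)).
  apply: le_trans (le_trans h1 _); last first.
    by rewrite /= expr0n addr0 add0r !sqrtr_sqr lerD.
  by rewrite /= addr0 add0r.
have lim n : exists z : R[i], forall e : R, 0 < e ->
    G [set x : E | Normc.normc (coef x n - z) <= e].
  have [a Ga] : exists a : R, forall e : R, 0 < e ->
      G [set x : E | `|complex.Re (coef x n) - a| <= e].
    apply: (rcauchy_functional (M := 1) GF cG) => [x y|x].
      by rewrite coefB raddfB.
    rewrite mul1r; exact: le_trans (normc_Re_Im _).1 (normc_coef_le _ _).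
  have [b Gb] : exists b : R, forall e : R, 0 < e ->
      G [set x : E | `|complex.Im (coef x n) - b| <= e].
    apply: (rcauchy_functional (M := 1) GF cG) => [x y|x].
      by rewrite coefB raddfB.
    rewrite mul1r; exact: le_trans (normc_Re_Im _).2 (normc_coef_le _ _).
  exists (a +i* b) => e e0; have e20 : 0 < e / 2 by rewrite divr_gt0.
  apply: filterS (filterI (Ga _ e20) (Gb _ e20)) => x [/= xa xb].
  by have := ReIm _ _ _ xa _ _ xb; rewrite -splitr.
have [l Gl] := choice lim.
have close (P : set E) (GP : G P) (r : R) : 0 < r ->
    (forall x y : E, P x -> P y -> rnorm (x - y) <= r) -> forall x : E, P x ->
    (\int[mu]_k (Normc.normc (coef x k - l k)%R)%:E <= (2 * r)%:E)%E.
  move=> r0 Pr x Px; apply: integral_le_window => [k|n]; first by rewrite lee_fin normc_ge0.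
  pose c := fine (mu (window n)).
  have c0 : 0 <= c by rewrite fine_ge0.
  (* Small enough for the window to have total error at most r. *)
  pose dl := r / (c + 1).
  have dl0 : 0 < dl by rewrite divr_gt0// ltr_wpDl.
  have [D DE] := finite_fsetP.1 (finite_window n).
  have GD : G (\bigcap_(k in [set` D]) [set y : E | Normc.normc (coef y k - l k) <= dl]).
    by apply: filter_bigI => k _; exact: Gl.
  have [y [Py yD]] := filter_ex (filterI GP GD).
  apply: (@le_trans _ _ (\int[mu]_(k in window n)
      ((Normc.normc (coef (x - y)%R k))%:E + dl%:E))%E).
    apply: ge0_le_integral => //.
      by move=> k _; rewrite lee_fin normc_ge0.
    move=> k kn; rewrite -EFinD lee_fin coefB.
    have -> : coef x k - l k = (coef x k - coef y k) + (coef y k - l k).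
      by rewrite addrA subrK.
    apply: le_trans (le_normcD _ _) _; rewrite lerD2l.
    by apply: yD; rewrite -DE.
  rewrite ge0_integralD//; first last.
  - by move=> k _; rewrite lee_fin ltW.
  - by move=> k _; rewrite lee_fin normc_ge0.
  rewrite integral_window_cst -/c.
  apply: (@le_trans _ _ (r%:E + r%:E)%E); last by rewrite -EFinD lee_fin; lra.
  apply: leeD; last first.
    rewrite lee_fin /dl mulrAC ler_pdivrMr ?ltr_wpDl//.
    by rewrite ler_wpM2l ?(ltW r0)// lerDl.
  apply: (@le_trans _ _ (rnorm (x - y))%:E); last by rewrite lee_fin Pr.
  rewrite rnorm_coefE; apply: ge0_subset_integral => // k _.
  by rewrite lee_fin normc_ge0.
have [P GP Pd] := cG 1 ltr01; have [x0 Px0] := filter_ex GP.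
have fin_l : (cLnorm mu 1 l < +oo)%E.
  rewrite cLnormE; apply: poweR_lty.
  have -> : (\int[mu]_k (`|Normc.normc (l k)| `^ 1)%:E =
      \int[mu]_k (Normc.normc (l k))%:E)%E.
    by apply: eq_integral => k _; rewrite powRr1 ger0_norm// normc_ge0.
  apply: (@le_lt_trans _ _ (\int[mu]_k ((Normc.normc (coef x0 k))%:E +
      (Normc.normc (coef x0 k - l k)%R)%:E))%E).
    apply: ge0_le_integral => //.
      by move=> k _; rewrite lee_fin normc_ge0.
    move=> k _; rewrite -EFinD lee_fin -[Normc.normc (coef x0 k - l k)]normcN opprB.
    have {1}-> : l k = coef x0 k + (l k - coef x0 k) by rewrite addrC subrK.
    exact: le_normcD.
  rewrite ge0_integralD//; first last.
  - by move=> k _; rewrite lee_fin normc_ge0.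
  - by move=> k _; rewrite lee_fin normc_ge0.
  rewrite -rnorm_coefE; apply: lte_add_pinfty; first exact: ltry.
  exact: le_lt_trans (close _ GP _ ltr01 Pd _ Px0) (ltry _).
exists (pi_Lp (to_LpFun (lexx (1 : R)) (@cmeasurable_int R l) fin_l)) => e e0.
have e20 : 0 < e / 2 by rewrite divr_gt0.
have [Q GQ Qd] := cG _ e20; apply: filterS (GQ) => x Qx /=.
rewrite -rnormN opprB -lee_fin rnorm_coefE.
have := close _ GQ _ e20 Qd _ Qx; rewrite mulrC divfK//; apply: le_trans.
rewrite le_eqVlt; apply/orP; left; apply/eqP; apply: eq_integral => k _.
by rewrite coefB coefE.
Qed.

End L1ZComplete.

Lemma val_isometric_homomorphism (K : numFieldType) (A : normedAlgType K)
  (B : closedSubalgebra A) : isometric_homomorphism (val : subAlg B -> A).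
Proof.
by split=> [a x y|x y|x]; rewrite ?val_subAlgD ?val_subAlgZ ?val_subAlgM.
Qed.

Lemma subAlg_acts_on_Lp (R : realType) d (T : measurableType d)
  (mu : {measure set T -> \bar R}) (p : R) (p1 : 1 <= p)
  (B : closedSubalgebra (Bop (Lp mu p1))) : acts_on_Lp (subAlg B) p p1.
Proof. by exists d, T, mu, val; exact: val_isometric_homomorphism. Qed.

Section F1ZBanach.
Context (R : realType).

Lemma F1Z_cauchy_cvg (G : set_system (F1Z R)) : ProperFilter G -> cauchy G -> cvg G.
Proof.
move=> GF; apply: rcomplete_cauchy_cvg.
exact: subAlg_rcomplete (Bop_rcomplete (@l1Z_rcomplete R)).
Qed.

Lemma F1Z_acts_on_L1 : acts_on_Lp (F1Z R) 1 (lexx 1).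
Proof.
exact: subAlg_acts_on_Lp.
Qed.

End F1ZBanach.

(** A name for the carrier of F^1(Z) to which the completeness structure can
    be attached. *)
Definition F1Z_carrier (R : realType) : Type := F1Z R.
HB.instance Definition _ (R : realType) := NormedAlgebra.on (F1Z_carrier R).
HB.instance Definition _ (R : realType) :=
  Uniform_isComplete.Build (F1Z_carrier R) (@F1Z_cauchy_cvg R).
Definition F1Z_banach (R : realType) : banachAlgType R[i] := F1Z_carrier R.

(** * The theorem *)

Theorem theorem6p2 (R : realType) :
  (exists J : closedIdeal (F1Z R),
    forall (p : R) (p1 : 1 <= p), ~ acts_on_Lp (quotAlg J) p p1) /\
  ~ (forall (A : banachAlgType R[i]) (J : closedIdeal A),
      acts_on_Lp A 1 (lexx 1) -> acts_on_Lp (quotAlg J) 1 (lexx 1)).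
Proof.
split; first by exists (cube_ideal R); exact: cube_quotient_not_acts.
move=> /(_ (F1Z_banach R) (cube_ideal R) (F1Z_acts_on_L1 R)).
exact: cube_quotient_not_acts.
Qed.
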